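(* Let $1<p<\infty$ and let $\omega:\mathbb{R}_+\to\mathbb{R}_+$ be continuous. Then: (i) $\mathcal{R}^0_{p,\omega}(0)$ is a closed subset of $D^{1,p}(\mathbb{R}_+,\omega)$ if and only if $\omega\in B_p(0)$. (ii) $\mathcal{R}^\infty_{p,\omega}(0)$ is a closed subset of $D^{1,p}(\mathbb{R}_+,\omega)$ if and only if $\omega\in B_p(\infty)$.
   Context: $\mathbb{R}_+=(0,\infty)$. $\omega\in B_p(0)$ means $\int_0^1\omega^{-1/(p-1)}\,d\tau<\infty$; $\omega\in B_p(\infty)$ means $\int_1^\infty\omega^{-1/(p-1)}\,d\tau<\infty$. $L^p(\mathbb{R}_+,\omega)$ is the space of measurable $f$ with $\|f\|_{L^p(\mathbb{R}_+,\omega)}=\big(\int_0^\infty|f|^p\omega\,dt\big)^{1/p}<\infty$. The weighted Dirichlet space $D^{1,p}(\mathbb{R}_+,\omega)$ consists of all locally absolutely continuous $u:\mathbb{R}_+\to\mathbb{R}$ with $\|u'\|_{L^p(\mathbb{R}_+,\omega)}<\infty$; its topology is given by any of the (mutually equivalent) norms $\|u\|^{(a)}_{D^{1,p}(\mathbb{R}_+,\omega)}=\|u'\|_{L^p(\mathbb{R}_+,\omega)}+|u(a)|$, $a\in\mathbb{R}_+$. Further, $$\mathcal{R}^0_{p,\omega}(0)=\Big\{u\in D^{1,p}(\mathbb{R}_+,\omega):\ u(t)=\int_0^t u'(\tau)\,d\tau\ \text{ for all }t>0\Big\},$$ $$\mathcal{R}^\infty_{p,\omega}(0)=\Big\{u\in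 D^{1,p}(\mathbb{R}_+,\omega):\ u(t)=\int_t^\infty v(\tau)\,d\tau\ \text{ for all }t>0,\ \text{for some }v\in L^p(\mathbb{R}_+,\omega)\Big\}.$$ Integrals are Lebesgue integrals, so membership includes the requirement that $u'$ be integrable near $0$ (respectively that $v$ be integrable near $\infty$). *)

(* Defs.v *)
From HB Require Import structures.
From mathcomp Require Import all_boot all_order all_algebra.
From mathcomp Require Import all_classical all_reals all_analysis.

Set Implicit Arguments.
Unset Strict Implicit.
Unset Printing Implicit Defensive.
Import Order.TTheory GRing.Theory Num.Theory.
Import numFieldNormedType.Exports.

Local Open Scope classical_set_scope.
Local Open Scope ring_scope.

(* Functions on the half-line (0, +oo) are total functions R -> R whose values
   on (-oo, 0] are never inspected by the notions below.  Two elements of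
   [dirichlet_space] that agree on (0, +oo) are thus topologically
   indistinguishable. *)

Section weighted_dirichlet.
Context {R : realType}.
Local Notation mu := (@lebesgue_measure R).

Implicit Types (p a b : R) (w f u : R -> R).

Definition Bp_zero p w : Prop :=
  (\int[mu]_(t in `]0%R, 1%R[) ((w t) `^ (- (p - 1)^-1))%:E < +oo)%E.

Definition Bp_infty p w : Prop :=
  (\int[mu]_(t in `]1%R, +oo[) ((w t) `^ (- (p - 1)^-1))%:E < +oo)%E.

Definition wLnorm p w f : \bar R :=
  ((\int[mu]_(t in `]0%R, +oo[) ((`|f t| `^ p) * w t)%:E) `^ p^-1)%E.

Definition wLp p w : set (R -> R) :=
  [set f | measurable_fun (`]0, +oo[ : set R) f /\ (wLnorm p w f < +oo)%E].

Definition abs_continuous a b u : Prop :=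
  forall e : R, 0 < e -> exists2 d : R, 0 < d &
    forall (n : nat) (s t : 'I_n -> R),
      (forall i, a <= s i /\ s i < t i /\ t i <= b) ->
      trivIset setT (fun i => `](s i), (t i)[%classic) ->
      \sum_(i < n) (t i - s i) < d ->
      \sum_(i < n) `|u (t i) - u (s i)| < e.

Definition loc_abs_continuous u : Prop :=
  forall a b, 0 < a -> a < b -> abs_continuous a b u.

(* [derive1 u] is the pointwise derivative, with value 0 where [u] is not
   differentiable; for a locally absolutely continuous [u] this happens only on
   a null subset of (0, +oo). *)
Definition dirichlet p w : set (R -> R) :=
  [set u | loc_abs_continuous u /\ wLp p w (derive1 u)].

Definition dirichlet_norm p w a u : \bar R :=
  (wLnorm p w (derive1 u) + `|u a|%:E)%E.

(* The parameter [a] selects the norm that defines the topology. *)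
Definition dirichlet_space p w (a : R) : Type := set_type (dirichlet p w).

Definition dirichlet_fun p w a (u : dirichlet_space p w a) : R -> R := val u.

HB.instance Definition _ p w a :=
  Choice.copy (dirichlet_space p w a) (set_type (dirichlet p w)).

Section norm_topology.
Variables (p : R) (w : R -> R) (a : R).
Local Notation D := (dirichlet_space p w a).

Definition dirichlet_ball (u : D) (r : R) : set D :=
  [set v | (dirichlet_norm p w a (dirichlet_fun v \- dirichlet_fun u)%R < r%:E)%E].

Definition dirichlet_open (U : set D) : Prop :=
  forall u : D, U u -> exists2 r : R, 0 < r & dirichlet_ball u r `<=` U.

Let openT : dirichlet_open setT.
Proof. by move=> u _; exists 1. Qed.

Let openI (U V : set D) :
  dirichlet_open U -> dirichlet_open V -> dirichlet_open (U `&` V).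
Proof.
move=> oU oV u [/oU[r r0 rU] /oV[s s0 sV]].
exists (Num.min r s); first by rewrite lt_min r0.
move=> v; rewrite /dirichlet_ball /= EFin_min lt_min => /andP[vr vs].
by split; [exact: rU|exact: sV].
Qed.

Let open_bigcup (I : Type) (F : I -> set D) :
  (forall i, dirichlet_open (F i)) -> dirichlet_open (\bigcup_i F i).
Proof.
move=> oF u [i _ /oF[r r0 rF]]; exists r => // v /rF Fv.
by exists i.
Qed.

HB.instance Definition _ :=
  isOpenTopological.Build D openT openI open_bigcup.

End norm_topology.

Definition R_zero p w a : set (dirichlet_space p w a) :=
  [set u | forall t : R, 0 < t ->
    mu.-integrable `]0, t] (EFin \o derive1 (dirichlet_fun u)) /\
    dirichlet_fun u t = \int[mu]_(x in `]0, t]) derive1 (dirichlet_fun u) x].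

Definition R_infty p w a : set (dirichlet_space p w a) :=
  [set u | exists2 v : R -> R, wLp p w v & forall t : R, 0 < t ->
    mu.-integrable `[t, +oo[ (EFin \o v) /\
    dirichlet_fun u t = \int[mu]_(x in `[t, +oo[) v x].

End weighted_dirichlet.

Arguments dirichlet_fun {R p w a} u.
Arguments R_zero {R} p w a _.
Arguments R_infty {R} p w a _.

(* Main.v *)
Require Import Defs.
From mathcomp Require Import all_boot all_order all_algebra.
From mathcomp Require Import all_classical all_reals all_analysis.
From HB Require Import structures.
From mathcomp Require Import measurable_realfun lra.

(** Write rho for the dual weight w ^ (-1/(p-1)).  The two conditions say that
    rho is integrable near 0, respectively near infinity.

    If rho is integrable on a set J, the pointwise inequality
    |h| <= tau rho + tau^(1-p) |h|^p w (lemma [weighted_young]) bounds the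
    integral of |h| over J by quantities that a small L^p(w)-norm makes
    small.  Applied to h = v' - u', it shows that for v close to u in the
    Dirichlet norm the integral of |v' - u'| over J is small
    ([dirichlet_norm_controls]); integrating from the base point a, so is v - u
    on J when J is an interval that contains a.  The representations
    u(t) = int_0^t u' and u(t) = - int_t^oo u' therefore pass to limits, which
    gives closedness ([Bp_zero_closed], [Bp_infty_closed]).

    If rho is not integrable near 0, take a continuous bump v proportional to
    a cutoff of rho, supported near 0, with integral 1.  Its energy, the
    integral of |v|^p w, is at most S^(1-p), where S is the mass of the cutoff
    of rho; S is as large as desired ([bump_small_norm]).  The primitive of v
    belongs to the first class, equals 1 at the base point and is as close as
    desired to the constant function 1, which is outside the class.  Near
    infinity the same is done with 1 minus a primitive
    ([not_Bp_zero_not_closed], [not_Bp_infty_not_closed]).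

    The elements of the space are only locally absolutely continuous, so the
    first half rests on the Lebesgue fundamental theorem for such functions: u
    is differentiable almost everywhere and is an integral of its derivative
    ([abs_continuous_density]).  The total variation of u is again absolutely
    continuous, which makes u a difference of two nondecreasing absolutely
    continuous functions.  The Lebesgue-Stieltjes measure of each of them is
    dominated by the Lebesgue measure; its Radon-Nikodym density is the
    derivative by the Lebesgue differentiation theorem. *)

Set Implicit Arguments.
Unset Strict Implicit.
Unset Printing Implicit Defensive.

Import Order.TTheory GRing.Theory Num.Theory.
Import numFieldNormedType.Exports.

Local Open Scope classical_set_scope.
Local Open Scope ring_scope.

(** * Almost-everywhere and integration preliminaries *)

Section preliminaries.
Context {R : realType}.
Local Notation mu := (@lebesgue_measure R).

Lemma ae_imply (P Q : R -> Prop) :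
  {ae mu, forall x, P x} -> (forall x, P x -> Q x) -> {ae mu, forall x, Q x}.
Proof. by move=> aeP PQ; apply: negligibleS aeP => x; apply: contra_not => /PQ. Qed.

Lemma ae_imply2 (P Q S : R -> Prop) :
  {ae mu, forall x, P x} -> {ae mu, forall x, Q x} ->
  (forall x, P x -> Q x -> S x) -> {ae mu, forall x, S x}.
Proof.
move=> aeP aeQ PQS; apply: negligibleS (negligibleU aeP aeQ) => x nS.
have [Px|nP] := pselect (P x); last by left.
by right; apply: contra_not nS; exact: PQS.
Qed.

Lemma integrable_EFinD (D : set (measurableTypeR R)) (f g : R -> R) :
  measurable D -> mu.-integrable D (EFin \o f) -> mu.-integrable D (EFin \o g) ->
  mu.-integrable D (EFin \o (f \+ g)).
Proof.
move=> mD fi gi; have := integrableD mD fi gi.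
by apply: eq_integrable => // x _ /=; rewrite EFinD.
Qed.

Lemma integrable_EFinB (D : set (measurableTypeR R)) (f g : R -> R) :
  measurable D -> mu.-integrable D (EFin \o f) -> mu.-integrable D (EFin \o g) ->
  mu.-integrable D (EFin \o (f \- g)).
Proof.
move=> mD fi gi; have := integrableB mD fi gi.
by apply: eq_integrable => // x _ /=; rewrite EFinB.
Qed.

Lemma integral_support (A D : set R) (f : R -> \bar R) : A `<=` D ->
  (forall t, D t -> ~ A t -> f t = 0%E) ->
  (\int[mu]_(t in D) f t = \int[mu]_(t in A) f t)%E.
Proof.
move=> AD f0; rewrite integral_mkcond [RHS]integral_mkcond; congr integral.
apply/funext => t; rewrite !patchE.
have [At|nAt] := pselect (A t); first by rewrite !mem_set//; exact: AD.
rewrite (memNset nAt); case: ifPn => // /set_mem Dt; exact: f0.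
Qed.

(** The integral of a nonnegative function is a supremum over the simple
    functions below it, so it is monotone on arbitrary functions.  This is
    applied to [derive1 (v \- u)], which agrees with the Borel function
    [derive1 v \- derive1 u] only almost everywhere. *)
Lemma ge0_le_integral_nonmeasurable (D : set R) (f g : R -> \bar R) :
  (forall x, D x -> (0 <= f x)%E) -> (forall x, D x -> (f x <= g x)%E) ->
  (\int[mu]_(x in D) f x <= \int[mu]_(x in D) g x)%E.
Proof.
move=> f0 fg; have g0 x : D x -> (0 <= g x)%E.
  by move=> Dx; exact: le_trans (f0 _ Dx) (fg _ Dx).
rewrite !ge0_integralE//; apply: le_ereal_sup => _ [h hf <-]; exists h => // x.
apply: le_trans (hf x) _; rewrite /patch; case: ifPn => // /set_mem; exact: fg.
Qed.

End preliminaries.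

(** * The total variation of an absolutely continuous function *)

Section absolute_continuity.
Context {R : realType}.
Local Notation mu := (@lebesgue_measure R).
Implicit Types (a b : R) (u : R -> R).

(** Absolute continuity for families indexed by any finite type, in which
    degenerate intervals are allowed: this is the form that survives the
    subdivision of intervals and the clamping of end points. *)
Lemma abs_continuous_finType a b u : abs_continuous a b u ->
  forall e : R, 0 < e -> exists2 d : R, 0 < d &
    forall (T : finType) (s t : T -> R),
      (forall i, a <= s i /\ s i <= t i /\ t i <= b) ->
      trivIset setT (fun i => `](s i), (t i)[%classic) ->
      \sum_i (t i - s i) < d -> \sum_i `|u (t i) - u (s i)| < e.
Proof.
move=> uac e /uac[d d0 H]; exists d => // T s t ab tI sd.
pose A := [pred i : T | s i < t i].
have sumA (G : T -> R) : (forall i, s i = t i -> G i = 0) ->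
    \sum_i G i = \sum_(i < #|A|) G (enum_val i).
  move=> G0; rewrite -big_enum_val [RHS]big_mkcond/=; apply: eq_bigr => i _.
  rewrite inE/=; case: ifPn => // sti; apply: G0; apply/eqP.
  by rewrite eq_le; have [_ [-> _]] := ab i; rewrite leNgt.
rewrite sumA; last by move=> i ->; rewrite subrr normr0.
apply: H => [i|i j _ _ ij|].
- have [? [_ ?]] := ab (enum_val i); split => //; split => //.
  by have := enum_valP i; rewrite inE.
- exact/enum_val_inj/tI.
- rewrite -(sumA (fun i => t i - s i))// => i ->; exact: subrr.
Qed.

Lemma itv_partition_pieces a b (l : seq R) (k : nat) : itv_partition a b l ->
  (k < size l)%N ->
  [/\ a <= nth b (a :: l) k, nth b (a :: l) k < nth b (a :: l) k.+1 &
      nth b (a :: l) k.+1 <= b].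
Proof.
move=> [pl /eqP lb] kl.
have sl : sorted <%R (a :: l) by [].
have H i j : (i < (size l).+1)%N -> (j < (size l).+1)%N ->
    (nth b (a :: l) i <= nth b (a :: l) j) = (i <= j)%N.
  by move=> *; rewrite lt_sorted_leq_nth.
have <- : nth b (a :: l) 0%N = a by [].
have e : nth b (a :: l) (size l) = b by rewrite -[RHS]lb (last_nth b).
split; first by rewrite H// ltnW.
- by rewrite ltNge H ?ltnn// ltnW.
- by rewrite -[leRHS]e H.
Qed.

Lemma itv_partition_pieces_trivIset a b (l : seq R) : itv_partition a b l ->
  trivIset setT (fun k : 'I_(size l) =>
    `](nth b (a :: l) k), (nth b (a :: l) k.+1)[%classic).
Proof.
move=> [pl _].
have H i j : (i < size l)%N -> (j < size l)%N -> (i < j)%N ->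
    nth b (a :: l) i.+1 <= nth b (a :: l) j.
  by move=> il jl ij; rewrite lt_sorted_leq_nth// inE/= ltnS// ltnW.
move=> i j _ _ [x []] /=; rewrite !in_itv/= => /andP[xi1 xi2] /andP[xj1 xj2].
apply/val_inj/eqP; rewrite eqn_leq; apply/andP; split; rewrite leqNgt;
  apply/negP => h.
  by have := H _ _ (ltn_ord j) (ltn_ord i) h; lra.
by have := H _ _ (ltn_ord i) (ltn_ord j) h; lra.
Qed.

(** Suprema chosen independently commute with a finite sum; the bound on all
    sums also makes each supremum finite. *)
Lemma sum_ereal_sup_le (I : finType) (A : I -> set R) (e : R) :
  (forall i, A i !=set0) -> (forall f : I -> R, (forall i, A i (f i)) ->
    \sum_i f i <= e) ->
  (\sum_i ereal_sup (EFin @` A i) <= e%:E)%E.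
Proof.
move=> A0 H.
have ubA i : has_ubound (A i).
  have [g gA] := choice A0.
  exists (e - \sum_(j | j != i) g j) => x Aix.
  have := H (fun j => if j == i then x else g j).
  rewrite (bigD1 i)//= eqxx (eq_bigr g); last by move=> j /negbTE ->.
  by rewrite lerBrDr; apply => j; case: ifPn => // /eqP ->.
under eq_bigr do rewrite ereal_sup_EFin//.
rewrite sumEFin lee_fin; apply/ler_addgt0Pr => r r0.
pose n : R := (#|I|.+1)%:R.
have n0 : 0 < n by [].
have : forall i, exists x, A i x /\ sup (A i) - r / n < x.
  move=> i; have rn0 : 0 < r / n by rewrite divr_gt0.
  have [x Aix xr] := sup_adherent rn0 (conj (A0 i) (ubA i)).
  by exists x.
move=> /choice[f fA].
have := H f (fun i => (fA i).1); rewrite -(lerD2r r); apply: le_trans.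
apply: (@le_trans _ _ (\sum_i (f i + r / n))).
  by apply: ler_sum => i _; rewrite -lerBlDr ltW// (fA i).2.
rewrite big_split/= lerD2l sumr_const -mulr_natr -mulrA ger_pMr// mulrC.
by rewrite ler_pdivrMr// mul1r ler_nat.
Qed.

(** Subdividing each interval of a small family gives another small family,
    whose increments add up to less than [e]; then take the supremum over all
    subdivisions. *)
Lemma abs_continuous_total_variation a b u : abs_continuous a b u ->
  forall e : R, 0 < e -> exists2 d : R, 0 < d &
    forall (T : finType) (s t : T -> R),
      (forall i, a <= s i /\ s i <= t i /\ t i <= b) ->
      trivIset setT (fun i => `](s i), (t i)[%classic) ->
      \sum_i (t i - s i) < d ->
      (\sum_i total_variation (s i) (t i) u <= e%:E)%E.
Proof.
move=> /abs_continuous_finType uac e /uac[d d0 H]; exists d => // T s t ab tI sd.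
rewrite /total_variation; apply: sum_ereal_sup_le => [i|f fV].
  have [_ []] := ab i; rewrite le_eqVlt => /predU1P[->|? _].
    by rewrite variationsxx; exists 0.
  exact: variations_neq0.
have /choice[l lP] : forall i, exists l, itv_partition (s i) (t i) l /\
    variation (s i) (t i) u l = f i.
  by move=> i; have [l ? ?] := fV i; exists l.
(* the pieces of all the subdivisions, as one finite family *)
pose S := {i : T & 'I_(size (l i))}.
pose s' (q : S) := nth (t (tag q)) (s (tag q) :: l (tag q)) (tagged q).
pose t' (q : S) := nth (t (tag q)) (s (tag q) :: l (tag q)) (tagged q).+1.
have pc (q : S) := itv_partition_pieces (lP (tag q)).1 (ltn_ord (tagged q)).
suff : \sum_q `|u (t' q) - u (s' q)| < e.
  move=> /ltW; apply: le_trans; rewrite -(sig_big_dep xpredT (fun=> xpredT)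
    (fun i (k : 'I_(size (l i))) => `|u (nth (t i) (s i :: l i) k.+1) -
       u (nth (t i) (s i :: l i) k)|))/=.
  by apply: ler_sum => i _; rewrite -(lP i).2 /variation big_mkord.
apply: H.
- move=> q; have [+ + +] := pc q; rewrite -/(s' q) -/(t' q) => h1 h2 h3.
  have [h4 [h5 h6]] := ab (tag q).
  by split; [lra|split; lra].
- move=> [i k] [j k'] _ _ [x []] /=; rewrite !in_itv/= => /andP[h1 h2] /andP[h3 h4].
  have [/= g1 g2 g3] := pc (existT _ i k).
  have [/= g1' g2' g3'] := pc (existT _ j k').
  have ij : i = j.
    apply: tI => //; exists x; split => /=; rewrite in_itv/=; apply/andP; split.
    + exact: le_lt_trans g1 h1.
    + exact: lt_le_trans h2 g3.
    + exact: le_lt_trans g1' h3.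
    + exact: lt_le_trans h4 g3'.
  subst j; congr existT.
  apply: (itv_partition_pieces_trivIset (lP i).1) => //.
  by exists x; split; rewrite /= in_itv/= ?h1 ?h2 ?h3 ?h4.
- apply: le_lt_trans sd; rewrite -(sig_big_dep xpredT (fun=> xpredT)
    (fun i (k : 'I_(size (l i))) => (nth (t i) (s i :: l i) k.+1) -
       (nth (t i) (s i :: l i) k)))/=.
  apply: ler_sum => i _.
  have := @telescope_sumr _ 0%N (size (l i)) (nth (t i) (s i :: l i)) (leq0n _).
  rewrite big_mkord => ->; rewrite lerB// -(last_nth (t i)).
  by have [[_ /eqP ->]] := lP i.
Qed.

(** The variation is at most 1 on every interval of length less than [d], and
    finitely many of these cover [[a, b]]. *)
Lemma abs_continuous_bounded_variation a b u : a <= b -> abs_continuous a b u ->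
  bounded_variation a b u.
Proof.
move=> ab /abs_continuous_total_variation /(_ _ ltr01)[d d0 H].
apply/bounded_variationP => //.
have short x y : a <= x -> x <= y -> y <= b -> y - x < d ->
    total_variation x y u \is a fin_num.
  move=> ax xy yb yxd; rewrite ge0_fin_numE ?total_variation_ge0//.
  have := H 'I_1 (fun=> x) (fun=> y).
  rewrite !big_ord1 => /(_ _ _ yxd) => h.
  apply: le_lt_trans (ltry 1); apply: h => //.
  by move=> i j _ _ _; rewrite !ord1.
suff [k] : exists k : nat, b - a <= k%:R * (d / 2).
  have : a <= b <= b by rewrite ab lexx.
  move: {1 2 4 5}b => x; elim: k x => [|k ih] x /andP[ax xb].
    rewrite mul0r subr_le0 => xa; have -> : x = a by apply/eqP; rewrite eq_le xa.
    by rewrite total_variationxx.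
  rewrite -natr1 mulrDl mul1r => xk.
  have [xad|xad] := leP (x - a) (d / 2).
    by apply: short => //; lra.
  rewrite (@total_variationD _ _ _ (x - d / 2)); [|lra..].
  rewrite fin_numD; apply/andP; split; last by apply: short; lra.
  by apply: ih; [apply/andP; split; lra|lra].
exists (Num.bound ((b - a) / (d / 2))).
by rewrite -ler_pdivrMr ?divr_gt0// ltW// archi_boundP// divr_ge0 ?subr_ge0// ltW// divr_gt0.
Qed.


End absolute_continuity.

(** * Densities of nondecreasing absolutely continuous functions *)

Section nondecreasing_density.
Context {R : realType}.
Local Notation mu := (@lebesgue_measure R).
Implicit Types (a b : R) (F G : R -> R).

(** Absolute continuity on the whole line, uniformly, for a nondecreasing
    function: increments need no absolute value. *)
Definition small_increments F : Prop :=
  forall e : R, 0 < e -> exists2 d : R, 0 < d &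
    forall (T : finType) (s t : T -> R), (forall i, s i <= t i) ->
      trivIset setT (fun i => `](s i), (t i)[%classic) ->
      \sum_i (t i - s i) < d -> \sum_i (F (t i) - F (s i)) <= e.

Lemma open_interval_bounds (I : set R) : open I -> is_interval I ->
  (mu I < +oo)%E -> exists s t, s <= t /\ I = `]s, t[%classic.
Proof.
move=> oI /is_intervalP Ihull muI.
have [i iI] : exists i : interval R, I = [set` i] by exists (Rhull I).
have [I0|/set0P/negP/negPn/eqP I0] := pselect (I !=set0); last first.
  by exists 0, 0; rewrite I0 set_itvoo0.
have {}oI : I = I°%classic by apply/esym/interior_id.
move: oI muI I0; rewrite iI {iI Ihull I}.
case: i => [[bx x|[|]] [by_ y|[|]]].
- rewrite interior_itv_bnd => -> _ [z] /=; rewrite in_itv/= => /andP[xz zy].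
  by exists x, y; split=> //; apply: ltW; exact: lt_trans xz zy.
- by move=> _ _ [z]; rewrite /= in_itv/= andbF.
- by rewrite lebesgue_measure_itv/= ltry.
- by rewrite lebesgue_measure_itv/= ltNyr.
- by move=> _ _ [z].
- by rewrite lebesgue_measure_itv/=.
- by move=> _ _ [z]; rewrite /= in_itv.
- by move=> _ _ [z]; rewrite /= in_itv.
- by move=> _ _ [z]; rewrite /= in_itv.
Qed.

(** The Lebesgue-Stieltjes measure of [G] is finite because [G] is constant
    outside [[a, b]].  It is dominated by the Lebesgue measure: a null set lies
    in an open set of measure less than [d], which is a countable disjoint
    union of open intervals, and every finite subfamily of these has
    [G]-increments of sum at most [e].  The density is given by the
    Radon-Nikodym theorem. *)
Lemma nondecreasing_small_increments_density a b G :
  {homo G : x y / x <= y} -> small_increments G ->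
  (forall x, x <= a -> G x = G a) -> (forall x, b <= x -> G x = G b) ->
  exists h : R -> R, mu.-integrable setT (EFin \o h) /\
    forall x, G x - G a = \int[mu]_(t in `]-oo, x]) h t.
Proof.
move=> Gnd Gsmall Ga Gb.
have Grc : right_continuous G.
  move=> x; apply/cvgrPdist_le => e e0; have [d d0 H] := Gsmall _ e0.
  near=> y; have xy : x < y by near: y; exact: nbhs_right_gt.
  rewrite distrC ger0_norm ?subr_ge0; last exact/Gnd/ltW.
  have := H 'I_1 (fun=> x) (fun=> y); rewrite !big_ord1; apply.
  - by move=> _; exact: ltW.
  - by move=> i j _ _ _; rewrite !ord1.
  - by rewrite ltrBlDl; near: y; apply: nbhs_right_lt; rewrite ltrDl.
pose Gc : cumulative R R := HB.pack G (isCumulative.Build R _ R G Gnd Grc).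
pose ls := lebesgue_stieltjes_measure Gc.
have lsoc x y : x <= y -> ls `]x, y]%classic = (G y - G x)%:E.
  move=> xy; rewrite /ls /lebesgue_stieltjes_measure /measure_extension.
  by rewrite measurable_mu_extE/= ?wlength_itv_bnd//; exact: is_ocitv.
have lsT : (ls setT <= (G b - G a)%:E)%E.
  have cv : ls `](- n%:R), n%:R]%classic @[n --> \oo] --> ls setT.
    rewrite -(bigcup_itvT false false).
    apply: nondecreasing_cvg_mu => //; first exact: bigcup_measurable.
    by move=> *; apply/subsetPset/subset_itv; rewrite leBSide/= ?lerN2 ler_nat.
  rewrite -(cvg_lim _ cv)//; apply: lime_le; first by apply/cvg_ex; eexists; exact: cv.
  apply: nearW => n; rewrite lsoc ?ge0_cp// lee_fin.
  have Gle x : G a <= G x.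
    by have [/Ga ->//|/ltW/Gnd] := leP x a.
  have Gge x : G x <= G b.
    by have [/Gnd//|/ltW/Gb ->//] := leP x b.
  by rewrite lerB.
have lsfin : fin_num_fun ls.
  move=> A mA; rewrite ge0_fin_numE//.
  rewrite (@le_lt_trans _ _ (ls setT))//; first by rewrite le_measure ?inE.
  by rewrite (le_lt_trans lsT)// ltry.
pose nu : {finite_measure set (measurableTypeR R) -> \bar R} :=
  HB.pack (lebesgue_stieltjes_measure Gc)
    (Measure_isFinite.Build _ (measurableTypeR R) R ls lsfin).
have numu : nu `<< mu.
  apply/null_content_dominatesP => N mN N0.
  apply/eqP; rewrite -measure_le0; apply/lee_addgt0Pr => e e0; rewrite add0e.
  have [d d0 H] := Gsmall _ e0.
  have Nfin : (mu N < +oo)%E by rewrite N0.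
  have [U [oU NU muU]] := lebesgue_regularity_outer mN Nfin d0.
  have mU : measurable (U : set (measurableTypeR R)) by exact: open_measurable.
  have {}muU : (mu U < d%:E)%E.
    apply: le_lt_trans muU; rewrite -[leRHS]add0e -N0 -measureU//.
    - rewrite le_measure ?inE//; last by rewrite setDUK.
      by apply: measurableU => //; exact: measurableD.
    - exact: measurableD.
    - by rewrite setDIK.
  have mI k : measurable (open_disjoint_itv oU k : set (measurableTypeR R)).
    by apply: open_measurable; exact: open_disjoint_itv_open.
  apply: (@le_trans _ _ (nu U)).
    by rewrite le_measure ?inE.
  have /choice[st stP] : forall k, exists st : R * R,
      st.1 <= st.2 /\ open_disjoint_itv oU k = `]st.1, st.2[%classic.
    move=> k; have Ifin : (mu (open_disjoint_itv oU k) < +oo)%E.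
      apply: le_lt_trans (ltry d); apply: le_trans (ltW muU).
      rewrite le_measure ?inE// => x Ix.
      by rewrite (open_disjoint_itv_bigcup oU); exists k.
    have [s [t [? ?]]] := open_interval_bounds (@open_disjoint_itv_open _ _ oU k)
      (@open_disjoint_itv_is_interval _ _ oU k) Ifin.
    by exists (s, t).
  have nuU : nu U = (\sum_(k <oo) nu (open_disjoint_itv oU k))%E.
    rewrite {1}(open_disjoint_itv_bigcup oU) measure_semi_bigcup//.
    - exact: open_disjoint_itv_trivIset.
    - exact: bigcup_measurable.
  rewrite nuU; apply: lime_le; first exact: is_cvg_nneseries.
  apply: nearW => n; rewrite big_mkord.
  apply: (@le_trans _ _ (\sum_(k < n) (G (st k).2 - G (st k).1)%:E)%E).
    apply: lee_sum => k _; have [st12 ->] := stP k; rewrite -lsoc//.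
    by rewrite /nu /= le_measure ?inE//; exact: subset_itv_oo_oc.
  rewrite sumEFin lee_fin.
  apply: (H 'I_n (fun k => (st k).1) (fun k => (st k).2)).
  - by move=> k; exact: (stP k).1.
  - move=> i j _ _; rewrite -(stP i).2 -(stP j).2 => ij.
    exact/val_inj/(@open_disjoint_itv_trivIset _ _ oU).
  - rewrite -lte_fin; apply: le_lt_trans muU; rewrite -sumEFin.
    rewrite {1}(open_disjoint_itv_bigcup oU).
    rewrite measure_semi_bigcup//; last 2 first.
    + exact: open_disjoint_itv_trivIset.
    + exact: bigcup_measurable.
    apply: (@le_trans _ _ (\sum_(k < n) mu (open_disjoint_itv oU k))%E).
      apply: lee_sum => k _; have [st12 ->] := stP k.
      rewrite lebesgue_measure_itv/= lte_fin.
      case: ifPn => //; rewrite -leNgt => st21.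
      by rewrite lee_fin subr_le0.
    rewrite -(big_mkord xpredT (fun k => mu (open_disjoint_itv oU k))).
    exact: nneseries_lim_ge.
have [f [f0 ffin fint fE]] := radon_nikodym_sigma_finite numu.
exists (fine \o f); have EfK : EFin \o (fine \o f) = f.
  by apply/funext => x /=; rewrite fineK.
split; first by rewrite EfK.
move=> x; rewrite /Rintegral.
have nuE : nu `]-oo, x]%classic = (\int[mu]_(t in `]-oo, x]) ((fine \o f) t)%:E)%E.
  by rewrite fE//; apply: eq_integral => t _ /=; rewrite fineK.
rewrite -nuE.
have cv : ls `](- n%:R), x]%classic @[n --> \oo] --> ls `]-oo, x]%classic.
  have <- : \bigcup_n `](- n%:R), x]%classic = `]-oo, x]%classic.
    by rewrite itvNybndEbigcup.
  apply: nondecreasing_cvg_mu => //; first exact: bigcup_measurable.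
  by move=> n m nm; apply/subsetPset/subset_itvr; rewrite leBSide/= lerN2 ler_nat.
have -> : nu `]-oo, x]%classic = ls `]-oo, x]%classic by [].
suff Gcv : ls `](- n%:R), x]%classic @[n --> \oo] --> (G x - G a)%:E.
  by rewrite -(cvg_lim _ cv)// (cvg_lim _ Gcv).
apply: cvg_near_cst; near=> n.
have na : - n%:R <= a.
  rewrite lerNl; near: n; exact: nbhs_infty_ger.
have nx : - n%:R <= x.
  rewrite lerNl; near: n; exact: nbhs_infty_ger.
by rewrite lsoc// (Ga (- n%:R)).
Unshelve. all: by end_near. Qed.

End nondecreasing_density.

(** * Absolutely continuous functions are indefinite integrals *)

Section fundamental_theorem.
Context {R : realType}.
Local Notation mu := (@lebesgue_measure R).
Implicit Types (a b : R) (u F G : R -> R).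

(** Projection onto [[a, b]], used to extend functions from [[a, b]] to the
    line by constants. *)
Definition clamp a b (x : R) := Num.max a (Num.min b x).

Lemma clamp_in a b x : a <= b -> a <= clamp a b x <= b.
Proof. by move=> ab; rewrite /clamp le_max lexx ge_max ab ge_min lexx. Qed.

Lemma clamp_id a b x : a <= x -> x <= b -> clamp a b x = x.
Proof. by move=> ax xb; rewrite /clamp (min_idPr xb) (max_idPr ax). Qed.

Lemma le_clamp a b : {homo clamp a b : x y / x <= y}.
Proof.
move=> x y xy; rewrite /clamp ge_max !le_max lexx/=.
by rewrite le_min !ge_min xy lexx/= orbT orbT.
Qed.

Lemma clamp_subset a b s t x : a <= b ->
  clamp a b s < x -> x < clamp a b t -> s < x /\ x < t.
Proof.
move=> ab; rewrite /clamp gt_max lt_max lt_min gt_min.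
move=> /andP[ax /orP[bx|sx]] /orP[xa|/andP[xb xt]]; split=> //; lra.
Qed.

Lemma clamp_sub_le a b s t : s <= t -> clamp a b t - clamp a b s <= t - s.
Proof.
move=> st; rewrite /clamp.
by case: (leP b t) => ?; case: (leP b s) => ?; case: (leP a b) => ?;
  case: (leP a t) => ?; case: (leP a s) => ?; lra.
Qed.

Lemma small_increments_clamp a b F : a <= b ->
  (forall e : R, 0 < e -> exists2 d : R, 0 < d &
    forall (T : finType) (s t : T -> R),
      (forall i, a <= s i /\ s i <= t i /\ t i <= b) ->
      trivIset setT (fun i => `](s i), (t i)[%classic) ->
      \sum_i (t i - s i) < d -> \sum_i (F (t i) - F (s i)) <= e) ->
  small_increments (F \o clamp a b).
Proof.
move=> ab H e /H[d d0 {}H]; exists d => // T s t st tI sd /=.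
apply: (H T (clamp a b \o s) (clamp a b \o t)) => [i|i j _ _ [x []]|].
- have /andP[h1 h2] := clamp_in (s i) ab; have /andP[h3 h4] := clamp_in (t i) ab.
  by split => //; split => //; exact: le_clamp.
- rewrite /= !in_itv/= => /andP[h1 h2] /andP[h3 h4].
  have [? ?] := clamp_subset ab h1 h2.
  have [? ?] := clamp_subset ab h3 h4.
  by apply: tI => //; exists x; split; rewrite /= in_itv/=; apply/andP.
- by apply: le_lt_trans sd; apply: ler_sum => i _; exact: clamp_sub_le.
Qed.

(** The Jordan decomposition u = V - (V - u), with V the variation of u from
    [a], reduces to nondecreasing functions.  The Lebesgue differentiation
    theorem identifies the density with the derivative. *)
Lemma abs_continuous_density a b u : a <= b -> abs_continuous a b u ->
  exists2 h : R -> R, mu.-integrable setT (EFin \o h) &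
    (forall x y, a <= x -> x <= y -> y <= b ->
       u y - u x = \int[mu]_(t in `[x, y]) h t) /\
    {ae mu, forall x, a < x -> x < b -> derivable u x 1 /\ derive1 u x = h x}.
Proof.
move=> ab uac.
have bv := abs_continuous_bounded_variation ab uac.
have TVfin x y : a <= x -> x <= y -> y <= b -> total_variation x y u \is a fin_num.
  move=> ax xy yb; apply/bounded_variationP => //.
  apply: (@bounded_variationl _ x y b) => //.
  by apply: (@bounded_variationr _ a x b) => //; exact: le_trans xy yb.
pose V x := fine (total_variation a x u).
have VB x y : a <= x -> x <= y -> y <= b -> V y - V x = fine (total_variation x y u).
  move=> ax xy yb; rewrite /V (total_variationD _ ax xy) fineD ?TVfin ?(le_trans ax xy)//.
    by rewrite addrC addKr.
  exact: le_trans yb.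
have Vge x y : a <= x -> x <= y -> y <= b -> `|u y - u x| <= V y - V x.
  move=> ax xy yb; rewrite VB// -lee_fin fineK ?TVfin//.
  exact: total_variation_ge.
pose F1 := V \o clamp a b; pose F2 := (V \- u) \o clamp a b.
have F1small : small_increments F1.
  apply: small_increments_clamp => // e e0.
  have [d d0 H] := abs_continuous_total_variation uac e0.
  exists d => // T s t st tI sd; have := H T s t st tI sd.
  rewrite -lee_fin -sumEFin; apply: le_trans; apply: lee_sum => i _.
  have [h1 [h2 h3]] := st i; rewrite VB// fineK ?TVfin//.
have F2small : small_increments F2.
  apply: small_increments_clamp => // e e0.
  have [d d0 H] := abs_continuous_total_variation uac (divr_gt0 e0 (ltr0n _ 2)).
  exists d => // T s t st tI sd; have := H T s t st tI sd.
  move=> {}H; rewrite (splitr e).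
  rewrite -lee_fin; apply: le_trans (leeD H H); rewrite -big_split/= -sumEFin.
  apply: lee_sum => i _; have [h1 [h2 h3]] := st i.
  rewrite -[total_variation _ _ _]fineK ?TVfin// -VB// -EFinD lee_fin.
  have := Vge _ _ h1 h2 h3; rewrite ler_norml => /andP[]; lra.
have F1nd : {homo F1 : x y / x <= y}.
  move=> x y /(le_clamp a b) cxy; rewrite /F1 /=.
  have /andP[h1 h2] := clamp_in x ab; have /andP[h3 h4] := clamp_in y ab.
  by have := le_trans (normr_ge0 _) (Vge _ _ h1 cxy h4); rewrite subr_ge0.
have F2nd : {homo F2 : x y / x <= y}.
  move=> x y /(le_clamp a b) cxy; rewrite /F2 /=.
  have /andP[h1 h2] := clamp_in x ab; have /andP[h3 h4] := clamp_in y ab.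
  have := Vge _ _ h1 cxy h4; rewrite ler_norml => /andP[]; lra.
have ca x : x <= a -> clamp a b x = a.
  by move=> xa; rewrite /clamp; apply/max_idPl; rewrite ge_min xa orbT.
have cb x : b <= x -> clamp a b x = b.
  by move=> bx; rewrite /clamp (min_idPl bx); exact/max_idPr.
have [h1 [ih1 h1E]] := @nondecreasing_small_increments_density _ a b F1 F1nd F1small
  (fun x xa => congr1 V (etrans (ca x xa) (esym (ca a (lexx a)))))
  (fun x bx => congr1 V (etrans (cb x bx) (esym (cb b (lexx b))))).
have [h2 [ih2 h2E]] := @nondecreasing_small_increments_density _ a b F2 F2nd F2small
  (fun x xa => congr1 (V \- u) (etrans (ca x xa) (esym (ca a (lexx a)))))
  (fun x bx => congr1 (V \- u) (etrans (cb x bx) (esym (cb b (lexx b))))).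
have ih : mu.-integrable setT (EFin \o (h1 \- h2)).
  exact: integrable_EFinB.
have hE x : a <= x -> x <= b -> u x - u a = \int[mu]_(t in `]-oo, x]) (h1 \- h2) t.
  move=> ax xb; rewrite RintegralB//; [|exact: integrableS ih1|exact: integrableS ih2].
  rewrite -h1E -h2E /F1 /F2 /= !clamp_id//; lra.
exists (h1 \- h2) => //; split.
  move=> x y ax xy yb.
  rewrite -Rintegral_itv_obnd_cbnd; last exact: integrableS ih.
  rewrite -(@Rintegral_itvB _ (h1 \- h2) -oo%O); [|exact: integrableS ih|by []|by rewrite bnd_simp].
  rewrite -!hE//; [lra|exact: le_trans yb|exact: le_trans xy].
have ihy y : mu.-integrable `]-oo, y] (EFin \o (h1 \- h2)).
  exact: integrableS ih.
have := FTC1Ny ihy (open_integrable_locally openT ih).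
apply: filterS; first exact: (ae_filter_ringOfSetsType mu).
move=> x [dx dxE] ax xb.
set F := fun y => _ in dx dxE.
have uF : \near x, F x + u a = u x.
  near=> y; rewrite /F -hE ?subrK//.
  - by apply: ltW; near: y; exact: lt_nbhsr.
  - by apply: ltW; near: y; exact: lt_nbhsl.
have dF : is_derive x 1 (F + cst (u a)) (derive1 F x + 0).
  apply: is_deriveD; rewrite derive1E; exact: DeriveDef.
have := near_eq_is_derive uF dF.
rewrite addr0 dxE => -[du uE]; split => //.
by rewrite derive1E.
Unshelve. all: by end_near. Qed.

End fundamental_theorem.

(** * Locally absolutely continuous functions on the half-line *)

Section local_fundamental_theorem.
Context {R : realType}.
Local Notation mu := (@lebesgue_measure R).
Implicit Types (x y : R) (u v : R -> R).

Lemma lipschitz_loc_abs_continuous (u : R -> R) (C : R) :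
  (forall x y, 0 < x -> x <= y -> `|u y - u x| <= C * (y - x)) ->
  loc_abs_continuous u.
Proof.
move=> uC x y x0 xy e e0.
have C0 : 0 < `|C| + 1 by rewrite ltr_pwDr.
exists (e / (`|C| + 1)); first by rewrite divr_gt0.
move=> n s t st _; rewrite ltr_pdivlMr// => H; apply: le_lt_trans H.
rewrite mulr_suml; apply: ler_sum => i _; have [h1 [h2 h3]] := st i.
apply: le_trans (uC _ _ (lt_le_trans x0 h1) (ltW h2)) _.
rewrite mulrC ler_wpM2l ?subr_ge0 ?ltW//.
by rewrite (le_lt_trans (ler_norm _))// ltrDl.
Qed.

(** The half-line is the union of the intervals from 1/(n+1) to n+1. *)
Lemma loc_abs_continuous_derivable u : loc_abs_continuous u ->
  {ae mu, forall x, 0 < x -> derivable u x 1}.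
Proof.
move=> uac.
have : forall n : nat, {ae mu, forall x, n.+1%:R^-1 < x -> x < n.+1%:R ->
    derivable u x 1}.
  move=> n; have [->|n0] := posnP n.
    by apply: aeW => x /=; rewrite invr1 => h1 h2; have := lt_trans h1 h2; rewrite ltxx.
  have n1 : 1 < n.+1%:R :> R by rewrite ltr1n.
  have nn : n.+1%:R^-1 < n.+1%:R :> R.
    by apply: (lt_trans _ n1); rewrite invf_lt1.
  have in0 : 0 < n.+1%:R^-1 :> R by rewrite invr_gt0.
  have [h _ [_ H]] := abs_continuous_density (ltW nn) (uac _ _ in0 nn).
  apply: (ae_imply H).
  by move=> x {}H h1 h2; case: (H h1 h2).
move=> /ae_foralln /ae_imply; apply => x H x0.
pose n := maxn (Num.bound x) (Num.bound x^-1).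
have xn : x < n.+1%:R.
  apply: (@lt_le_trans _ _ (Num.bound x)%:R).
    by rewrite archi_boundP ?ltW ?invr_gt0.
  by rewrite ler_nat; apply: leqW; exact: leq_maxl.
have xn' : x^-1 < n.+1%:R.
  apply: (@lt_le_trans _ _ (Num.bound x^-1)%:R).
    by rewrite archi_boundP ?ltW ?invr_gt0.
  by rewrite ler_nat; apply: leqW; exact: leq_maxr.
by apply: (H n) => //; rewrite -[ltRHS]invrK ltf_pV2 // posrE ?invr_gt0.
Qed.

Lemma loc_abs_continuous_FTC u x y : loc_abs_continuous u ->
  measurable_fun (`]0, +oo[ : set R) (derive1 u) -> 0 < x -> x <= y ->
  mu.-integrable `[x, y] (EFin \o derive1 u) /\
  u y - u x = \int[mu]_(t in `[x, y]) derive1 u t.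
Proof.
move=> uac mu' x0 xy.
have x20 : 0 < x / 2 by rewrite divr_gt0.
have xy1 : x / 2 < y + 1 by lra.
have [h ih [hE ae]] := abs_continuous_density (ltW xy1) (uac _ _ x20 xy1).
have m1 : measurable_fun (`[x, y] : set R) (EFin \o derive1 u).
  apply/measurable_EFinP; apply: measurable_funS mu' => // t /=.
  by rewrite !in_itv/= andbT => /andP[xt _]; exact: lt_le_trans xt.
have ih' : mu.-integrable `[x, y] (EFin \o h) by exact: integrableS ih.
have m2 := measurable_int _ ih'.
have aeE : ae_eq mu `[x, y]%classic (EFin \o derive1 u) (EFin \o h).
  apply: (ae_imply ae) => t /= H; rewrite in_itv/= => /andP[xt ty].
  by have [_ ->] : derivable u t 1 /\ derive1 u t = h t by apply: H; lra.
split; last first.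
  rewrite hE; [|lra|by []|lra].
  by rewrite /Rintegral; congr fine; apply: ae_eq_integral => //; exact: ae_eq_sym.
apply/integrableP; split => //.
have /integrableP[_] := ih'; congr (_ < _)%E.
apply: ae_eq_integral => //; try exact: measurableT_comp.
exact/ae_eq_abse/ae_eq_sym.
Qed.

(** Since [derive1] takes a default value where the derivative does not exist,
    this holds only at the points where both functions are differentiable. *)
Lemma loc_abs_continuous_derive1B u v :
  loc_abs_continuous u -> loc_abs_continuous v ->
  {ae mu, forall x, 0 < x -> derive1 (v \- u) x = derive1 v x - derive1 u x}.
Proof.
move=> /loc_abs_continuous_derivable du /loc_abs_continuous_derivable dv.
apply: (ae_imply2 du dv) => x {}du {}dv x0.
by rewrite !derive1E deriveB//; [exact: dv|exact: du].
Qed.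

End local_fundamental_theorem.

(** * The dual weight and the weighted energy *)

Section weight.
Context {R : realType} (p : R) (w : R -> R).
Local Notation mu := (@lebesgue_measure R).
Hypothesis hp : 1 < p.
Hypothesis w_cont : {within `]0, +oo[, continuous w}.
Hypothesis w_pos : forall t : R, 0 < t -> 0 < w t.
Implicit Types (x y t : R) (u v f : R -> R) (J : set R).

(** The weight of the dual space: by Hoelder's inequality L^p(w) embeds in L^1
    on the sets where it has finite integral. *)
Definition dual_weight t : R := w t `^ (- (p - 1)^-1).
Local Notation rho := dual_weight.

(** The [p]-th power of the norm of L^p(w). *)
Definition energy f : \bar R :=
  (\int[mu]_(t in `]0%R, +oo[) ((`|f t| `^ p) * w t)%:E)%E.

Lemma dual_weight_ge0 t : 0 <= rho t. Proof. exact: powR_ge0. Qed.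

Lemma dual_weight_gt0 t : 0 < t -> 0 < rho t.
Proof. by move=> t0; rewrite powR_gt0// w_pos. Qed.

Lemma dual_weight_powR t : 0 < t -> rho t `^ (p - 1) = (w t)^-1.
Proof.
move=> t0; have p1 : 0 < p - 1 by rewrite subr_gt0.
by rewrite -powRrM mulNr mulVf ?gt_eqF// powR_inv1// ltW// w_pos.
Qed.

Lemma weight_continuous t : 0 < t -> {for t, continuous w}.
Proof.
move=> t0; have t0' : t \in (`]0, +oo[%classic : set R) by rewrite inE/= in_itv/= andbT.
by move: w_cont; rewrite continuous_open_subspace//; exact.
Qed.

Lemma dual_weight_continuous t : 0 < t -> {for t, continuous rho}.
Proof.
move=> t0; apply: (@continuous_comp _ _ _ w (fun z => z `^ (- (p - 1)^-1))).
  exact: weight_continuous.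
apply: differentiable_continuous; apply/derivable1_diffP.
by apply: derivable_powR; rewrite in_itv/= andbT w_pos.
Qed.

Lemma measurable_weight : measurable_fun (`]0, +oo[ : set R) w.
Proof.
apply: open_continuous_measurable_fun => // t.
by rewrite inE/= in_itv/= andbT => /weight_continuous.
Qed.

Lemma measurable_dual_weight : measurable_fun (`]0, +oo[ : set R) rho.
Proof.
apply: open_continuous_measurable_fun => // t.
by rewrite inE/= in_itv/= andbT => /dual_weight_continuous.
Qed.

Lemma dual_weight_compact_lty x y : 0 < x ->
  (\int[mu]_(t in `[x, y]) (rho t)%:E < +oo)%E.
Proof.
move=> x0; suff /integrableP[_] : mu.-integrable `[x, y] (EFin \o rho).
  by under eq_integral do rewrite /= ger0_norm ?dual_weight_ge0//.
apply: continuous_compact_integrable; first exact: segment_compact.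
apply: continuous_in_subspaceT => t; rewrite inE/= in_itv/= => /andP[xt _].
exact/dual_weight_continuous/(lt_le_trans x0).
Qed.

(** A form of Young's inequality that plays the role of Hoelder's inequality.
    If |h| exceeds tau rho, then |h|^(p-1) exceeds
    tau^(p-1) rho^(p-1) = tau^(p-1) / w, so the second term is at least |h|. *)
Lemma weighted_young (tau h t : R) : 0 < tau -> 0 < t ->
  `|h| <= tau * rho t + (tau `^ (p - 1))^-1 * (`|h| `^ p * w t).
Proof.
move=> tau0 t0; have rt := dual_weight_gt0 t0; have wt := w_pos t0.
have p1 : 0 < p - 1 by rewrite subr_gt0.
have T0 : 0 < tau `^ (p - 1) by rewrite powR_gt0.
have second_ge0 : 0 <= (tau `^ (p - 1))^-1 * (`|h| `^ p * w t).
  by rewrite mulr_ge0 ?invr_ge0 ?mulr_ge0 ?powR_ge0// ltW.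
have [hle|hgt] := leP `|h| (tau * rho t).
  by rewrite (le_trans hle)// lerDl.
apply: (@le_trans _ _ ((tau `^ (p - 1))^-1 * (`|h| `^ p * w t))); last first.
  by rewrite lerDr mulr_ge0// ltW.
have p0 : 0 < p := lt_trans ltr01 hp.
rewrite -(@mulr_powRB1 _ `|h| p)//.
have rp := dual_weight_powR t0.
have : (tau * rho t) `^ (p - 1) <= `|h| `^ (p - 1).
  apply: ge0_ler_powR; rewrite ?nnegrE ?(ltW p1)//; last exact: ltW.
  by rewrite mulr_ge0// ltW.
rewrite powRM ?(ltW tau0) ?dual_weight_ge0// rp ler_pdivrMr// => H.
by rewrite [leRHS]mulrC ler_pdivlMr// -mulrA ler_wpM2l.
Qed.

Lemma integral_le_energy (tau : R) J f : 0 < tau -> measurable J ->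
  J `<=` `]0, +oo[ -> measurable_fun (`]0, +oo[ : set R) f ->
  (\int[mu]_(t in J) `|f t|%:E <= tau%:E * \int[mu]_(t in J) (rho t)%:E +
     ((tau `^ (p - 1))^-1)%:E * energy f)%E.
Proof.
move=> tau0 mJ J0 mf; set c := (_ ^-1)%R.
have c0 : 0 <= c by rewrite invr_ge0 powR_ge0.
have mrho : measurable_fun J (EFin \o rho).
  by apply/measurable_EFinP; apply: measurable_funS J0 measurable_dual_weight.
have men : measurable_fun (`]0, +oo[ : set R) (fun t => (`|f t| `^ p * w t)%:E).
  apply/measurable_EFinP; apply: measurable_funM; last exact: measurable_weight.
  by apply: measurableT_comp (measurable_powR _) _; exact: measurableT_comp.
have menJ : measurable_fun J (fun t => (`|f t| `^ p * w t)%:E).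
  exact: measurable_funS J0 men.
have en0 t : (`]0%R, +oo[%classic : set R) t -> (0 <= (`|f t| `^ p * w t)%:E)%E.
  rewrite /= in_itv/= andbT => t0.
  by rewrite lee_fin mulr_ge0 ?powR_ge0// ltW// w_pos.
apply: (@le_trans _ _ (\int[mu]_(t in J) (tau%:E * (rho t)%:E +
    c%:E * (`|f t| `^ p * w t)%:E))%E).
  apply: ge0_le_integral_nonmeasurable => t Jt; first by rewrite lee_fin.
  rewrite -!EFinM -EFinD lee_fin weighted_young//.
  by have := J0 _ Jt; rewrite /= in_itv/= andbT.
rewrite ge0_integralD//; last 4 first.
- by move=> t _; rewrite -EFinM lee_fin mulr_ge0 ?dual_weight_ge0// ltW.
- by apply: measurable_funeM.
- by move=> t /J0 /en0 h; rewrite mule_ge0// lee_fin.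
- by apply: measurable_funeM.
rewrite ge0_integralZl//; last 2 first.
- by move=> t _; rewrite lee_fin dual_weight_ge0.
- by rewrite lee_fin ltW.
rewrite leeD2l// ge0_integralZl//; last by move=> t /J0 /en0.
rewrite lee_pmul2l ?fin_numE//; last by rewrite lte_fin invr_gt0 powR_gt0.
exact: ge0_subset_integral.
Qed.

Lemma energy_ge0 f : (0 <= energy f)%E.
Proof.
apply: integral_ge0 => t /=; rewrite in_itv/= andbT => t0.
by rewrite lee_fin mulr_ge0 ?powR_ge0// ltW// w_pos.
Qed.

Lemma wLnorm_lty f : (wLnorm p w f < +oo)%E -> (energy f < +oo)%E.
Proof.
have p0 : 0 < p := lt_trans ltr01 hp.
by apply: lty_poweRy; rewrite invr_eq0 gt_eqF.
Qed.

Lemma wLnorm_lt f (r : R) : 0 < r -> (wLnorm p w f < r%:E)%E ->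
  (energy f <= (r `^ p)%:E)%E.
Proof.
have p0 : 0 < p := lt_trans ltr01 hp.
move=> r0 /ltW fr; rewrite -poweR_EFin -[energy f]poweRe1 ?energy_ge0//.
rewrite -[X in (energy f `^ X)%E](mulVf (lt0r_neq0 p0)) poweRrM.
by apply: gt0_ler_poweR; rewrite ?in_itv/= ?leey ?andbT ?poweR_ge0 ?lee_fin ?(ltW r0) ?(ltW p0).
Qed.

(** Off a Borel null set the two derivatives agree, and removing this set does
    not change the left-hand side, whose integrand is measurable. *)
Lemma energy_derive1B u v : loc_abs_continuous u -> loc_abs_continuous v ->
  measurable_fun (`]0, +oo[ : set R) (derive1 u) ->
  measurable_fun (`]0, +oo[ : set R) (derive1 v) ->
  (energy (derive1 v \- derive1 u)%R <= energy (derive1 (v \- u)%R))%E.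
Proof.
move=> uac vac mu' mv'; have [N [mN N0 HN]] := loc_abs_continuous_derive1B uac vac.
have ge t (f : R -> R) : (`]0%R, +oo[%classic : set R) t ->
    (0 <= (`|f t| `^ p * w t)%:E)%E.
  rewrite /= in_itv/= andbT => t0.
  by rewrite lee_fin mulr_ge0 ?powR_ge0// ltW// w_pos.
rewrite /energy (ge0_negligible_integral _ _ _ _ N0)//; last 2 first.
- apply/measurable_EFinP; apply: measurable_funM; last exact: measurable_weight.
  apply: measurableT_comp (measurable_powR _) _; apply: measurableT_comp => //.
  exact: measurable_funB.
- by move=> t; exact: ge.
rewrite integral_mkcond [leRHS]integral_mkcond.
apply: ge0_le_integral_nonmeasurable => t _.
  by rewrite patchE; case: ifPn => // /set_mem [? _]; exact: ge.
rewrite !patchE; case: ifPn => [/set_mem[t0 Nt]|_]; last first.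
  by case: ifPn => // /set_mem ?; exact: ge.
rewrite mem_set//; have -> // : derive1 (v \- u) t = derive1 v t - derive1 u t.
apply: contrapT => ne; apply/Nt/HN => /= H; apply/ne/H.
by move: t0; rewrite /= in_itv/= andbT.
Qed.

End weight.

(** * Integrals over right half-lines *)

Section tails.
Context {R : realType}.
Local Notation mu := (@lebesgue_measure R).

(** If the tails are constant, every interval of length 1 starting at some
    [t + n] has integral zero, and these intervals partition the half-line. *)
Lemma constant_tail_eq0 (f : R -> R) (t c : R) :
  mu.-integrable `[t, +oo[ (EFin \o f) ->
  (forall s, t <= s -> \int[mu]_(x in `[s, +oo[) f x = c) -> c = 0.
Proof.
move=> fi fc.
pose I (n : nat) := `[t + n%:R, t + n.+1%:R[%classic : set R.
have IE : `[t, +oo[%classic = \bigcup_n I n.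
  apply/seteqP; split => x /=; last first.
    move=> [n _]; rewrite /I/= !in_itv/= andbT => /andP[+ _].
    by apply: le_trans; rewrite lerDl.
  rewrite in_itv/= andbT => tx; exists (Num.truncn (x - t)) => //.
  have /truncn_itv/andP[h1 h2] : 0 <= x - t by rewrite subr_ge0.
  by rewrite /I/= in_itv/=; apply/andP; split; lra.
have IT : trivIset setT I.
  move=> m n _ _ [x []]; rewrite /I /= !in_itv/= => /andP[h1 h2] /andP[h3 h4].
  apply/eqP; rewrite eqn_leq; apply/andP.
  by split; rewrite -ltnS -(ltr_nat R); lra.
have I0 n : (\int[mu]_(x in I n) (f x)%:E = 0)%E.
  have ts : t <= t + n%:R by rewrite lerDl.
  have ss : t + n%:R < t + n.+1%:R by rewrite ltrD2l ltr_nat.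
  have fis : mu.-integrable `[t + n%:R, +oo[ (EFin \o f).
    by apply: integrableS fi => //; apply: subset_itvr; rewrite bnd_simp.
  have := fc _ ts.
  rewrite (@itv_bndbnd_setU _ _ _ (BLeft (t + n.+1%:R))) ?bnd_simp ?(ltW ss)//.
  rewrite Rintegral_setU//=; last 2 first.
  - rewrite -itv_bndbnd_setU ?bnd_simp ?(ltW ss)//.
  - apply/disj_setPS => y [] /=; rewrite !in_itv/= andbT => /andP[_ h1] h2.
    by move: h1; rewrite ltNge h2.
  rewrite fc; last by rewrite lerDl.
  move/eqP; rewrite addrC -subr_eq0 addrAC subrr add0r => /eqP.
  move=> h; rewrite -[LHS]fineK; first by congr EFin.
  apply: integrable_fin_num; first exact: measurable_itv.
  have Isub : I n `<=` `[t + n%:R, +oo[ by apply: subset_itvl; rewrite bnd_simp.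
  exact: (@integrableS _ _ _ mu _ (I n) (EFin \o f) (measurable_itv _)
    (measurable_itv _) Isub fis).
rewrite -(fc t (lexx t)) /Rintegral IE integral_bigcup//.
- by rewrite eseries0.
- by move=> k; exact: measurable_itv.
- by rewrite -IE.
Qed.

(** The density [v] of a representation at infinity may be replaced with
    [- derive1 g]: the tails of [derive1 g \+ v] do not depend on their origin,
    so they vanish. *)
Lemma integral_representation_infty (g v : R -> R) (t : R) :
  loc_abs_continuous g -> measurable_fun (`]0, +oo[ : set R) (derive1 g) ->
  0 < t -> mu.-integrable `[t, +oo[ (EFin \o derive1 g) ->
  (forall s, 0 < s -> mu.-integrable `[s, +oo[ (EFin \o v) /\
    g s = \int[mu]_(x in `[s, +oo[) v x) ->
  g t = - \int[mu]_(x in `[t, +oo[) derive1 g x.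
Proof.
move=> gac mg t0 ig gv.
have igs s : t <= s -> mu.-integrable `[s, +oo[ (EFin \o derive1 g).
  by move=> ts; apply: integrableS ig => //; apply: subset_itvr; rewrite bnd_simp.
have tail s : t <= s ->
    \int[mu]_(x in `[s, +oo[) (derive1 g \+ v) x = 
    \int[mu]_(x in `[t, +oo[) derive1 g x + g t.
  move=> ts; have s0 := lt_le_trans t0 ts; have [iv gs] := gv _ s0.
  rewrite RintegralD//; last exact: igs.
  rewrite -gs.
  have [_ gst] := loc_abs_continuous_FTC gac mg t0 ts.
  have := @Rintegral_itvB _ _ (BLeft t) +oo%O s ig.
  rewrite Rintegral_itv_obnd_cbnd; last first.
    by apply: integrableS ig => //; apply: subset_itvr; rewrite bnd_simp.
  by rewrite !bnd_simp => /(_ ts isT) <-; rewrite -gst; lra.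
have : mu.-integrable `[t, +oo[ (EFin \o (derive1 g \+ v)).
  by apply: integrable_EFinD => //; exact: (gv _ t0).1.
move=> /constant_tail_eq0 /(_ tail); lra.
Qed.

End tails.

(** * Sufficiency of the weight conditions *)

Section closed_direction.
Context {R : realType} (p : R) (w : R -> R) (a : R).
Local Notation mu := (@lebesgue_measure R).
Hypothesis hp : 1 < p.
Hypothesis w_cont : {within `]0, +oo[, continuous w}.
Hypothesis w_pos : forall t : R, 0 < t -> 0 < w t.
Hypothesis ha : 0 < a.
Implicit Types (x y t : R) (u v f : R -> R) (J : set R).
Local Notation rho := (dual_weight p w).

(** Open sets are defined by balls around each of their points, so closedness
    is tested on balls that miss the set; this spares the triangle inequality
    that openness of balls would require. *)
Lemma dirichlet_closedP (S : set (dirichlet_space p w a)) :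
  closed S <-> forall u : dirichlet_space p w a, ~ S u ->
    exists2 r : R, 0 < r & dirichlet_ball u r `<=` ~` S.
Proof.
split=> [/closed_openC oS u Su|H]; first by have [r r0 rS] := oS _ Su; exists r.
have oS : open (~` S) := H.
by rewrite -[S]setCK; exact: open_closedC.
Qed.

Lemma dirichlet_integrable J u : measurable J -> J `<=` `]0, +oo[ ->
  (\int[mu]_(t in J) (rho t)%:E < +oo)%E -> dirichlet p w u ->
  mu.-integrable J (EFin \o derive1 u).
Proof.
move=> mJ J0 rhoJ [uac [mu' /(wLnorm_lty hp) en]].
apply/integrableP; split.
  by apply/measurable_EFinP; apply: measurable_funS mu'.
apply: le_lt_trans (integral_le_energy hp w_cont w_pos ltr01 mJ J0 mu') _.
rewrite mul1e powR1 invr1 mul1e; exact: lte_add_pinfty.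
Qed.

(** Choose first tau so that tau times the mass of the dual weight is at most
    e/2, then the radius so that the energy term is at most e/2. *)
Lemma dirichlet_norm_controls J : measurable J -> J `<=` `]0, +oo[ ->
  (\int[mu]_(t in J) (rho t)%:E < +oo)%E ->
  forall e : R, 0 < e -> exists2 r : R, 0 < r & forall u v,
    dirichlet p w u -> dirichlet p w v ->
    (dirichlet_norm p w a (v \- u)%R < r%:E)%E ->
    `|v a - u a| <= e /\
    (\int[mu]_(t in J) `|derive1 v t - derive1 u t|%:E <= e%:E)%E.
Proof.
move=> mJ J0 rhoJ e e0.
have p0 : 0 < p := lt_trans ltr01 hp.
have rho_ge0 : (0 <= \int[mu]_(t in J) (rho t)%:E)%E.
  by apply: integral_ge0 => t _; rewrite lee_fin dual_weight_ge0.
pose B := fine (\int[mu]_(t in J) (rho t)%:E)%E.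
have BE : (\int[mu]_(t in J) (rho t)%:E = B%:E)%E by rewrite fineK// ge0_fin_numE.
have B0 : 0 <= B by exact: fine_ge0.
pose tau := e / 2 / (B + 1).
have B1 : 0 < B + 1 by lra.
have tau0 : 0 < tau by rewrite !divr_gt0.
have tauB : tau * B <= e / 2.
  rewrite /tau -mulrA ger_pMr ?divr_gt0// mulrC ler_pdivrMr; lra.
pose C := (tau `^ (p - 1))^-1.
have C0 : 0 < C by rewrite invr_gt0 powR_gt0.
pose s := (e / 2 / C) `^ p^-1.
have s0 : 0 < s by rewrite powR_gt0 ?divr_gt0.
have sp : C * s `^ p = e / 2.
  rewrite /s -powRrM mulVf ?gt_eqF// powRr1 ?divr_ge0 ?ltW ?divr_gt0//.
  by rewrite mulrC divfK// gt_eqF.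
exists (Num.min e s); first by rewrite lt_min e0.
move=> u v [uac [mu' _]] [vac [mv' _]]; rewrite /dirichlet_norm => nvu.
have wn0 : (0 <= wLnorm p w (derive1 (v \- u)%R))%E by exact: poweR_ge0.
split.
  rewrite -lee_fin ltW//; apply: le_lt_trans (lt_le_trans nvu _).
    by rewrite leeDr.
  by rewrite lee_fin ge_min lexx.
have : (wLnorm p w (derive1 (v \- u)%R) < s%:E)%E.
  apply: le_lt_trans (lt_le_trans nvu _); first by rewrite leeDl.
  by rewrite lee_fin ge_min lexx orbT.
move=> /(wLnorm_lt hp w_pos s0) en.
have mvu : measurable_fun (`]0, +oo[ : set R) (derive1 v \- derive1 u).
  exact: measurable_funB.
apply: le_trans (integral_le_energy hp w_cont w_pos tau0 mJ J0 mvu) _.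
rewrite BE -/C [e]splitr EFinD -EFinM leeD ?lee_fin//.
rewrite -sp EFinM; apply: lee_wpmul2l; first by rewrite lee_fin ltW.
by apply: le_trans en; exact: energy_derive1B.
Qed.

Lemma Rintegral_derive1B_le J I u v (e : R) : measurable J -> J `<=` `]0, +oo[ ->
  measurable I -> I `<=` J ->
  dirichlet p w u -> dirichlet p w v ->
  (\int[mu]_(t in J) (rho t)%:E < +oo)%E ->
  (\int[mu]_(t in J) `|derive1 v t - derive1 u t|%:E <= e%:E)%E ->
  `|\int[mu]_(t in I) derive1 v t - \int[mu]_(t in I) derive1 u t| <= e.
Proof.
move=> mJ J0 mI IJ Du Dv rhoJ H.
have iu : mu.-integrable I (EFin \o derive1 u).
  exact: integrableS (dirichlet_integrable mJ J0 rhoJ Du).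
have iv : mu.-integrable I (EFin \o derive1 v).
  exact: integrableS (dirichlet_integrable mJ J0 rhoJ Dv).
have [_ [mu' _]] := Du; have [_ [mv' _]] := Dv.
rewrite -RintegralB//.
have iuv : mu.-integrable I (EFin \o (derive1 v \- derive1 u)).
  exact: integrable_EFinB.
rewrite (le_trans (le_normr_Rintegral _ iuv))// -lee_fin fineK; last first.
  apply: integrable_fin_num => //; exact: (integrable_abse iuv).
apply: le_trans H; apply: ge0_subset_integral => //.
apply/measurable_EFinP; apply: measurableT_comp => //.
apply: (measurable_funS _ J0) => //; exact: measurable_funB.
Qed.

Lemma derive1_increment_le J u v x y (e : R) : measurable J -> J `<=` `]0, +oo[ ->
  dirichlet p w u -> dirichlet p w v -> 0 < x -> x <= y -> `[x, y] `<=` J ->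
  (\int[mu]_(t in J) (rho t)%:E < +oo)%E ->
  (\int[mu]_(t in J) `|derive1 v t - derive1 u t|%:E <= e%:E)%E ->
  `|(v y - u y) - (v x - u x)| <= e.
Proof.
have subrACA (b c d e' : R) : (b - c) - (d - e') = (b - d) - (c - e') by lra.
move=> mJ J0 Du Dv x0 xy xyJ rhoJ H.
have [[uac [mu' _]] [vac [mv' _]]] := (Du, Dv).
have [_ uE] := loc_abs_continuous_FTC uac mu' x0 xy.
have [_ vE] := loc_abs_continuous_FTC vac mv' x0 xy.
by rewrite subrACA uE vE; exact: (Rintegral_derive1B_le mJ J0).
Qed.

(** The dual weight is continuous and positive, so only its behaviour at 0 and
    at infinity matters: adding a compact interval preserves integrability. *)
Lemma dual_weight_lty_setU (A D : set R) x y : measurable A -> measurable D ->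
  A `<=` `]0, +oo[ -> 0 < x -> D `<=` A `|` `[x, y] ->
  (\int[mu]_(t in A) (rho t)%:E < +oo)%E ->
  (\int[mu]_(t in D) (rho t)%:E < +oo)%E.
Proof.
move=> mA mD A0 x0 DA Afin.
have rho0 t : (0 <= (rho t)%:E :> \bar R)%E by rewrite lee_fin dual_weight_ge0.
have xy0 : `[x, y] `<=` `]0, +oo[.
  move=> t /=; rewrite !in_itv/= andbT => /andP[xt _]; exact: lt_le_trans xt.
have mrho (E : set R) : E `<=` `]0, +oo[ -> measurable_fun E (EFin \o rho).
  move=> E0; apply/measurable_EFinP; apply: measurable_funS E0 _ => //.
  exact: measurable_dual_weight.
have mxy : measurable (`[x, y] `\` A) by apply: measurableD.
apply: (@le_lt_trans _ _ (\int[mu]_(t in A `|` (`[x, y] `\` A)) (rho t)%:E)%E).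
  apply: ge0_subset_integral => //; first exact: measurableU.
  - by apply: mrho => t [/A0//|[/xy0]].
  - by move=> t /DA [|xyt]; [left|have [|] := pselect (A t); [left|right]].
rewrite ge0_integral_setU//; last 2 first.
- by apply: mrho => t [/A0//|[/xy0]].
- by apply/disj_setPS => t [At [_]].
apply: lte_add_pinfty => //.
apply: le_lt_trans (dual_weight_compact_lty p w_cont w_pos y x0).
by apply: ge0_subset_integral => //; apply: mrho.
Qed.

Lemma Bp_zero_lty c : Bp_zero p w -> (\int[mu]_(t in `]0%R, c]) (rho t)%:E < +oo)%E.
Proof.
apply: (@dual_weight_lty_setU _ _ 1 c) => //.
  by move=> t /=; rewrite !in_itv/= andbT => /andP[].
move=> t /=; rewrite !in_itv/= => /andP[t0 tc].
by have [t1|t1] := ltP t 1; [left; rewrite t0|right].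
Qed.

Lemma Bp_infty_lty c : 0 < c -> Bp_infty p w ->
  (\int[mu]_(t in `[c, +oo[) (rho t)%:E < +oo)%E.
Proof.
move=> c0; apply: (@dual_weight_lty_setU _ _ c 1) => //.
  by move=> t /=; rewrite !in_itv/= !andbT; apply: lt_trans.
move=> t /=; rewrite !in_itv/= !andbT => tc.
by have [t1|t1] := ltP 1 t; [left|right; rewrite tc].
Qed.

(** Splitting of the defect [x - i] of a representation, where [x] and [y] are
    the values at t of u and of its approximant, [b] is their difference at the
    base point, and [i] stands for the integral of the derivative of u. *)
Lemma le_norm_thirds (x y b i e : R) : `|b| <= e / 3 -> `|(y - x) - b| <= e / 3 ->
  `|y - i| <= e / 3 -> `|x - i| <= e.
Proof.
rewrite !ler_norml => /andP[? ?] /andP[? ?] /andP[? ?].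
by apply/andP; split; lra.
Qed.

Lemma le_norm_thirdsN (x y b i j e : R) : `|b| <= e / 3 ->
  `|(y - x) - b| <= e / 3 -> `|j - i| <= e / 3 -> y = - j -> `|x - - i| <= e.
Proof.
by move=> hb hy ji yj; apply: le_norm_thirds hb hy _; rewrite yj -opprD normrN.
Qed.

Lemma approximation_in_closure (S : set (dirichlet_space p w a))
    (u : dirichlet_space p w a) J (e : R) :
  ~ (exists2 r : R, 0 < r & dirichlet_ball u r `<=` ~` S) ->
  measurable J -> J `<=` `]0, +oo[ ->
  (\int[mu]_(t in J) (rho t)%:E < +oo)%E -> 0 < e ->
  exists v : dirichlet_space p w a, [/\ S v,
    `|dirichlet_fun v a - dirichlet_fun u a| <= e &
    (\int[mu]_(t in J) `|derive1 (dirichlet_fun v) t -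
       derive1 (dirichlet_fun u) t|%:E <= e%:E)%E].
Proof.
move=> uS mJ J0 rhoJ e0; have [r r0 rP] := dirichlet_norm_controls mJ J0 rhoJ e0.
apply: contrapT => nv; apply: uS; exists r => // v uv Sv; apply: nv; exists v.
by have [? ?] := rP _ _ (set_mem (valP u)) (set_mem (valP v)) uv.
Qed.

(** The norm controls the value at the base point [a] only; other points are
    reached by integrating the derivative from [a]. *)
Lemma increment_from_basepoint_le J u v t (e : R) :
  measurable J -> J `<=` `]0, +oo[ ->
  dirichlet p w u -> dirichlet p w v -> 0 < t ->
  `[Num.min a t, Num.max a t] `<=` J ->
  (\int[mu]_(t in J) (rho t)%:E < +oo)%E ->
  (\int[mu]_(t in J) `|derive1 v t - derive1 u t|%:E <= e%:E)%E ->
  `|(v t - u t) - (v a - u a)| <= e.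
Proof.
move=> mJ J0 Du Dv t0; have [at_|ta] := leP a t => sJ rhoJ H.
  exact: (derive1_increment_le mJ J0).
by rewrite distrC; apply: (derive1_increment_le mJ J0 Du Dv) => //; exact: ltW.
Qed.

(** The interval [J] contains both the domain of integration and the segment
    from the base point [a] to [t]. *)
Lemma Bp_zero_closed : Bp_zero p w -> closed (R_zero p w a).
Proof.
move=> Bp; apply/dirichlet_closedP => u uS; apply: contrapT => H; apply: uS => t t0.
pose J := `]0, Num.max a t]%classic : set R.
have mJ : measurable J by exact: measurable_itv.
have J0 : J `<=` `]0, +oo[ by move=> x /=; rewrite /J/= !in_itv/= andbT => /andP[].
have rhoJ := @Bp_zero_lty (Num.max a t) Bp.
have tJ : `]0, t] `<=` J by apply: subset_itvl; rewrite bnd_simp le_max lexx orbT.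
have hJ : `[Num.min a t, Num.max a t] `<=` J.
  by apply: subset_itvr; rewrite bnd_simp lt_min ha.
have Du : dirichlet p w (dirichlet_fun u) := set_mem (valP u).
split; first exact: integrableS (dirichlet_integrable mJ J0 rhoJ Du).
apply/eqP; rewrite -subr_eq0 -normr_le0; apply/ler_addgt0Pr => e e0; rewrite add0r.
have e30 : 0 < e / 3 by rewrite divr_gt0.
have [v [Sv va vJ]] := approximation_in_closure H mJ J0 rhoJ e30.
have Dv : dirichlet p w (dirichlet_fun v) := set_mem (valP v).
have := increment_from_basepoint_le mJ J0 Du Dv t0 hJ rhoJ vJ.
have := Rintegral_derive1B_le mJ J0 (measurable_itv _) tJ Du Dv rhoJ vJ.
by have [_ <-] := Sv t t0 => h1 h2; exact: le_norm_thirds va h2 h1.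
Qed.

Lemma Bp_infty_closed : Bp_infty p w -> closed (R_infty p w a).
Proof.
move=> Bp; apply/dirichlet_closedP => u uS; apply: contrapT => H; apply: uS.
have Du : dirichlet p w (dirichlet_fun u) := set_mem (valP u).
have [_ [mu' nu']] := Du.
exists (\- derive1 (dirichlet_fun u)).
  split; first exact: measurable_funN.
  by rewrite /wLnorm; under eq_integral do rewrite normrN.
move=> t t0.
pose J := `[Num.min a t, +oo[%classic : set R.
have mJ : measurable J by exact: measurable_itv.
have mn0 : 0 < Num.min a t by rewrite lt_min ha.
have J0 : J `<=` `]0, +oo[.
  by move=> x /=; rewrite /J/= !in_itv/= !andbT; apply: lt_le_trans.
have rhoJ := Bp_infty_lty mn0 Bp.
have tJ : `[t, +oo[ `<=` J by apply: subset_itvr; rewrite bnd_simp ge_min lexx orbT.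
have hJ : `[Num.min a t, Num.max a t] `<=` J by apply: subset_itvl; rewrite bnd_simp.
have it f : dirichlet p w f -> mu.-integrable `[t, +oo[ (EFin \o derive1 f).
  by move=> Df; apply: integrableS (dirichlet_integrable mJ J0 rhoJ Df).
split.
  have := integrableN (it _ Du).
  by apply: eq_integrable => // x _ /=; rewrite EFinN.
have -> : \int[mu]_(x in `[t, +oo[) (\- derive1 (dirichlet_fun u)) x =
    - \int[mu]_(x in `[t, +oo[) derive1 (dirichlet_fun u) x.
  under eq_Rintegral do rewrite /= -mulN1r.
  by rewrite RintegralZl ?mulN1r//; exact: it.
apply/eqP; rewrite -subr_eq0 -normr_le0; apply/ler_addgt0Pr => e e0; rewrite add0r.
have e30 : 0 < e / 3 by rewrite divr_gt0.
have [v [[vv _ vvE] va vJ]] := approximation_in_closure H mJ J0 rhoJ e30.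
have Dv : dirichlet p w (dirichlet_fun v) := set_mem (valP v).
have := increment_from_basepoint_le mJ J0 Du Dv t0 hJ rhoJ vJ.
have := Rintegral_derive1B_le mJ J0 (measurable_itv _) tJ Du Dv rhoJ vJ.
have [vac [mv' _]] := Dv.
have vt := integral_representation_infty vac mv' t0 (it _ Dv) vvE.
move=> h1 h2; exact: le_norm_thirdsN va h2 h1 vt.
Qed.

End closed_direction.

(** * Smooth transitions of small weighted norm *)

Section primitive.
Context {R : realType}.
Local Notation mu := (@lebesgue_measure R).

Variables (x y : R) (v : R -> R).
Hypothesis x0 : 0 < x.
Hypothesis xy : x <= y.
Hypothesis v_cont : continuous v.
Hypothesis v_ge0 : forall t, 0 <= v t.
Hypothesis v_left : forall t, t <= x -> v t = 0.
Hypothesis v_right : forall t, y <= t -> v t = 0.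
Hypothesis v_mass : \int[mu]_(t in `[x, y]) v t = 1.

Definition primitive t : R := \int[mu]_(s in `[0, t]) v s.

Lemma bump_support t : ~ (`[x, y]%classic : set R) t -> v t = 0.
Proof.
rewrite /= in_itv/= => /negP; rewrite negb_and -!ltNge => /orP[|] /ltW.
  exact: v_left.
exact: v_right.
Qed.

Lemma bump_integrable : mu.-integrable setT (EFin \o v).
Proof.
have : mu.-integrable `[x, y] (EFin \o v).
  apply: continuous_compact_integrable; first exact: segment_compact.
  exact: continuous_subspaceT.
move=> /integrableP[_ vfin]; apply/integrableP; split.
  by apply/measurable_EFinP; exact: continuous_measurable_fun.
rewrite (@integral_support _ `[x, y]%classic)// => t _ /bump_support vt.
by rewrite /= vt normr0.
Qed.

Lemma primitive_derivable (t : R) : 0 < t -> is_derive t 1 primitive (v t).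
Proof.
move=> t0; have t1 : t < t + 1 by rewrite ltrDl.
have iv : mu.-integrable `[0, t + 1] (EFin \o v) by exact: integrableS bump_integrable.
have [dU UE] := continuous_FTC1_closed t1 iv t0 (@v_cont t).
by rewrite -UE derive1E; exact: DeriveDef.
Qed.

Lemma primitive_derive1 (t : R) : 0 < t -> derive1 primitive t = v t.
Proof. by move=> /primitive_derivable dU; rewrite derive1E derive_val. Qed.

Lemma primitive_left (t : R) : t <= x -> primitive t = 0.
Proof.
move=> tx; rewrite /primitive /Rintegral integral0_eq// => s /=.
by rewrite in_itv/= => /andP[_ st]; rewrite v_left// (le_trans st).
Qed.

Lemma primitive_right (t : R) : y <= t -> primitive t = 1.
Proof.
move=> yt; rewrite -v_mass /primitive /Rintegral (@integral_support _ `[x, y]%classic)//.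
  by apply: subset_itv; rewrite bnd_simp// ltW.
by move=> s _ /bump_support ->.
Qed.

Lemma primitive_loc_abs_continuous : loc_abs_continuous primitive.
Proof.
have [c _ vc] := EVT_max xy (continuous_subspaceT v_cont).
apply: (@lipschitz_loc_abs_continuous _ _ (v c)) => s t s0.
rewrite le_eqVlt => /predU1P[->|st]; first by rewrite !subrr normr0 mulr0.
have dU z : z \in `]s, t[ -> is_derive z 1 primitive (v z).
  by rewrite in_itv/= => /andP[sz _]; apply: primitive_derivable; exact: lt_trans sz.
have cU : {within `[s, t], continuous primitive}.
  apply: continuous_in_subspaceT => z; rewrite inE/= in_itv/= => /andP[sz _].
  have [dz _] := primitive_derivable (lt_le_trans s0 sz).
  exact/differentiable_continuous/derivable1_diffP.
have [z _ ->] := MVT st dU cU.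
have ts : 0 <= t - s by rewrite subr_ge0 ltW.
rewrite normrM ger0_norm// (ger0_norm ts) ler_wpM2r//.
have [zxy|/bump_support ->] := pselect ((`[x, y]%classic : set R) z); last exact: v_ge0.
exact: vc.
Qed.

Lemma primitiveE (t : R) : 0 < t -> primitive t = \int[mu]_(s in `]0, t]) derive1 primitive s.
Proof.
move=> t0; rewrite /primitive -Rintegral_itv_obnd_cbnd.
  apply: eq_Rintegral => s; rewrite inE/= in_itv/= => /andP[s0 _].
  by rewrite primitive_derive1.
exact: integrableS bump_integrable.
Qed.

(** The bump has mass 1, so its tail is the complement of its primitive: this
    transition from 1 to 0 is represented at infinity by the bump itself. *)
Lemma primitive_complement (t : R) : 0 < t ->
  1 - primitive t = \int[mu]_(s in `[t, +oo[) v s.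
Proof.
move=> t0; rewrite -Rintegral_itv_obnd_cbnd; last exact: integrableS bump_integrable.
have i0 : mu.-integrable `[0, +oo[ (EFin \o v) by exact: integrableS bump_integrable.
rewrite -(@Rintegral_itvB _ v (BLeft 0) +oo%O t i0) ?bnd_simp ?ltW//.
congr (_ - _); rewrite -v_mass /Rintegral [in RHS](@integral_support _ `[x, y]%classic)//.
  by move=> s /=; rewrite !in_itv/= andbT => /andP[xs _]; rewrite ltW// (lt_le_trans x0).
by move=> s _ /bump_support ->.
Qed.

End primitive.

Section bump.
Context {R : realType} (p : R) (w : R -> R).
Local Notation mu := (@lebesgue_measure R).
Hypothesis hp : 1 < p.
Hypothesis w_cont : {within `]0, +oo[, continuous w}.
Hypothesis w_pos : forall t : R, 0 < t -> 0 < w t.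
Local Notation rho := (dual_weight p w).

(** The continuous cutoff equal to 1 on [[x, y]], to 0 outside [[x', y']], and
    affine in between. *)
Definition trapezoid (x' x y y' t : R) : R :=
  Num.max 0 (Num.min 1 (Num.min ((t - x') / (x - x')) ((y' - t) / (y' - y)))).

Lemma trapezoid_continuous x' x y y' : continuous (trapezoid x' x y y').
Proof.
pose f1 (t : R) : R^o := (t - x') / (x - x').
pose f2 (t : R) : R^o := (y' - t) / (y' - y).
have c1 : continuous f1.
  by move=> t; apply: cvgMl; apply: cvgB; [exact: cvg_id|exact: cvg_cst].
have c2 : continuous f2.
  by move=> t; apply: cvgMl; apply: cvgB; [exact: cvg_cst|exact: cvg_id].
have c3 t : {for t, continuous ((cst 1 : R -> R^o) \min (f1 \min f2))}.
  by apply: continuous_min; [exact: cvg_cst|exact: (continuous_min (c1 t) (c2 t))].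
move=> t; have := @continuous_max _ _ (cst 0 : R -> R^o) _ t _ (c3 t).
by apply; exact: cvg_cst.
Qed.

Lemma trapezoid_in01 x' x y y' t : 0 <= trapezoid x' x y y' t <= 1.
Proof. by rewrite /trapezoid le_max lexx ge_max ler01 ge_min lexx. Qed.

Lemma trapezoid_eq0 x' x y y' t : x' < x -> y < y' ->
  t <= x' \/ y' <= t -> trapezoid x' x y y' t = 0.
Proof.
move=> xx yy tt; apply/max_idPl; rewrite !ge_min; case: tt => h.
  by rewrite ler_pdivrMr ?mul0r ?subr_le0 ?h ?orbT// subr_gt0.
by rewrite [X in _ || (_ || X)]ler_pdivrMr ?mul0r ?subr_le0 ?h ?orbT// subr_gt0.
Qed.

Lemma trapezoid_eq1 x' x y y' t : x' < x -> y < y' ->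
  x <= t -> t <= y -> trapezoid x' x y y' t = 1.
Proof.
move=> xx yy xt ty; rewrite /trapezoid (min_idPl _) ?(max_idPr _)//.
rewrite le_min !ler_pdivlMr ?subr_gt0// !mul1r lerB// lerB//.
Qed.

(** The bump is the cutoff of the dual weight rho divided by its mass S.  As
    v <= rho / S and rho^(p-1) w = 1, one has |v|^p w <= S^(1-p) v, whose
    integral is S^(1-p).  The hypothesis on [r] bounds the mass of
    rho on [[x, y]], hence S, from below, so that S^(1-p) < r^p. *)
Lemma bump_small_norm (x' x y y' r : R) :
  0 < x' -> x' < x -> x <= y -> y < y' -> 0 < r ->
  (((r `^ p) `^ (- (p - 1)^-1))%:E < \int[mu]_(t in `[x, y]) (rho t)%:E)%E ->
  exists v : R -> R, [/\ continuous v, forall t, 0 <= v t,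
    forall t, t <= x' -> v t = 0, forall t, y' <= t -> v t = 0 &
    \int[mu]_(t in `[x', y']) v t = 1 /\ (wLnorm p w v < r%:E)%E].
Proof.
move=> x'0 xx xy yy r0 Kr.
have p0 : 0 < p := lt_trans ltr01 hp.
have p1 : 0 < p - 1 by rewrite subr_gt0.
have xy' : x' <= y' by lra.
pose phi := trapezoid x' x y y'.
(* rho is known to be continuous only on the half-line; [phi] vanishes where
   the argument is changed *)
pose g t := phi t * rho (Num.max x' t).
have g_cont : continuous g.
  move=> t; apply: continuousM; first exact: trapezoid_continuous.
  apply: (@continuous_comp _ _ _ (fun t => Num.max x' t) rho).
    have := @continuous_max _ _ (cst x' : R -> R^o) (id : R -> R^o) t.
    by apply; [exact: cvg_cst|exact: cvg_id].
  by apply: dual_weight_continuous => //; rewrite lt_max x'0.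
have g_ge0 t : 0 <= g t.
  by rewrite mulr_ge0 ?dual_weight_ge0//; have /andP[] := trapezoid_in01 x' x y y' t.
have gl t : t <= x' -> g t = 0.
  by move=> h; rewrite /g /phi trapezoid_eq0 ?mul0r//; left.
have gr t : y' <= t -> g t = 0.
  by move=> h; rewrite /g /phi trapezoid_eq0 ?mul0r//; right.
have g_le t : 0 < t -> g t <= rho t.
  move=> t0; have [/gl ->|x't] := leP t x'; first exact: dual_weight_ge0.
  rewrite /g (max_idPr (ltW x't)) ler_piMl ?dual_weight_ge0//.
  by have /andP[] := trapezoid_in01 x' x y y' t.
have ig : mu.-integrable `[x', y'] (EFin \o g).
  apply: continuous_compact_integrable; first exact: segment_compact.
  exact: continuous_subspaceT.
pose S := \int[mu]_(t in `[x', y']) g t.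
have SE : (\int[mu]_(t in `[x', y']) (g t)%:E = S%:E)%E.
  by rewrite fineK//; exact: integrable_fin_num.
pose K := (r `^ p) `^ (- (p - 1)^-1).
have KS : K < S.
  rewrite -lte_fin -SE; apply: lt_le_trans Kr _.
  have -> : (\int[mu]_(t in `[x, y]) (rho t)%:E = \int[mu]_(t in `[x, y]) (g t)%:E)%E.
    apply: eq_integral => t; rewrite inE/= in_itv/= => /andP[xt ty].
    by rewrite /g /phi trapezoid_eq1// mul1r (max_idPr _)// (le_trans (ltW xx)).
  apply: ge0_subset_integral => //.
  - by apply/measurable_EFinP; apply: measurable_funTS; exact: continuous_measurable_fun.
  - by move=> t _; rewrite lee_fin.
  - by apply: subset_itv; rewrite bnd_simp ltW.
have K0 : 0 <= K by exact: powR_ge0.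
have S0 : 0 < S := le_lt_trans K0 KS.
pose v t := S^-1 * g t.
have v_ge0 t : 0 <= v t by rewrite mulr_ge0// invr_ge0 ltW.
have v_cont : continuous v.
  by move=> t; apply: cvgM; [exact: cvg_cst|exact: g_cont].
have vl t : t <= x' -> v t = 0 by rewrite /v => /gl ->; rewrite mulr0.
have vr t : y' <= t -> v t = 0 by rewrite /v => /gr ->; rewrite mulr0.
have v1 : \int[mu]_(t in `[x', y']) v t = 1.
  by rewrite RintegralZl// -/S mulVf// gt_eqF.
exists v; split => //; split => //.
have v_en : (energy p w v <= ((S `^ (p - 1))^-1)%:E)%E.
  apply: (@le_trans _ _ (\int[mu]_(t in `]0%R, +oo[)
      (((S `^ (p - 1))^-1)%:E * (v t)%:E))%E).
    apply: ge0_le_integral_nonmeasurable => t /=; rewrite in_itv/= andbT => t0.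
      by rewrite lee_fin mulr_ge0 ?powR_ge0// ltW// w_pos.
    rewrite -EFinM lee_fin (ger0_norm (v_ge0 t)) -(@mulr_powRB1 _ (v t) p)//.
    rewrite [leRHS]mulrC -mulrA; apply: ler_wpM2l => //.
    have vrho : v t `^ (p - 1) <= (S^-1 * rho t) `^ (p - 1).
      apply: ge0_ler_powR; rewrite ?nnegrE ?(ltW p1)//.
        by rewrite mulr_ge0 ?dual_weight_ge0// invr_ge0 ltW.
      by rewrite ler_wpM2l ?invr_ge0 ?(ltW S0)// g_le.
    apply: le_trans (ler_wpM2r (ltW (w_pos t0)) vrho) _.
    rewrite powRM ?invr_ge0 ?(ltW S0) ?dual_weight_ge0//.
    rewrite (dual_weight_powR hp w_pos t0) -mulrA mulVf ?gt_eqF ?w_pos// mulr1.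
    have -> // : S^-1 `^ (p - 1) = (S `^ (p - 1))^-1.
    by rewrite -(powR_inv1 (ltW S0)) -powRrM mulN1r powRN.
  rewrite ge0_integralZl//; last 3 first.
  - by apply/measurable_EFinP; apply: measurable_funTS; exact: continuous_measurable_fun.
  - by move=> t _; rewrite lee_fin.
  - by rewrite lee_fin invr_ge0 powR_ge0.
  rewrite (@integral_support _ `[x', y']%classic); last 2 first.
  - by move=> t /=; rewrite !in_itv/= andbT => /andP[+ _]; exact: lt_le_trans.
  - move=> t _ /=; rewrite in_itv/= => /negP; rewrite negb_and -!ltNge => /orP[|] /ltW h.
      by rewrite vl.
    by rewrite vr.
  have -> : (\int[mu]_(t in `[x', y']) (v t)%:E = 1%:E)%E.
    rewrite -v1 fineK//; apply: integrable_fin_num => //.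
    apply: continuous_compact_integrable; first exact: segment_compact.
    exact: continuous_subspaceT.
  by rewrite mule1.
have Sr : (S `^ (p - 1))^-1 < r `^ p.
  rewrite -[ltRHS]invrK ltf_pV2 ?posrE ?invr_gt0 ?powR_gt0//.
  have -> : (r `^ p)^-1 = K `^ (p - 1).
    by rewrite /K -powRrM mulNr mulVf ?gt_eqF// powR_inv1// powR_ge0.
  by apply: gt0_ltr_powR; rewrite ?nnegrE// ltW.
have en_fin : energy p w v \is a fin_num.
  by rewrite ge0_fin_numE ?energy_ge0//; exact: le_lt_trans v_en (ltry _).
rewrite /wLnorm -/(energy p w v) -(fineK en_fin) poweR_EFin lte_fin.
have -> : r = (r `^ p) `^ p^-1 by rewrite -powRrM mulfV ?gt_eqF// powRr1// ltW.
apply: gt0_ltr_powR; rewrite ?invr_gt0 ?nnegrE ?powR_ge0//.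
  by apply: fine_ge0; exact: energy_ge0.
apply: le_lt_trans Sr; rewrite -lee_fin fineK//.
Qed.

End bump.

(** * Necessity of the weight conditions *)

Section not_closed.
Context {R : realType} (p : R) (w : R -> R) (a : R).
Local Notation mu := (@lebesgue_measure R).
Hypothesis hp : 1 < p.
Hypothesis w_cont : {within `]0, +oo[, continuous w}.
Hypothesis w_pos : forall t : R, 0 < t -> 0 < w t.
Hypothesis ha : 0 < a.
Local Notation rho := (dual_weight p w).

Lemma integral_bigcup_le (F : nat -> set R) (K : \bar R) :
  (forall n, F n `<=` `]0, +oo[) -> (forall n, measurable (F n)) ->
  {homo F : n m / (n <= m)%N >-> n `<=` m} ->
  (forall n, \int[mu]_(t in F n) (rho t)%:E <= K)%E ->
  (\int[mu]_(t in \bigcup_n F n) (rho t)%:E <= K)%E.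
Proof.
move=> F0 mF ndF FK.
have cv : (\int[mu]_(t in F n) (rho t)%:E @[n --> \oo] -->
    \int[mu]_(t in \bigcup_n F n) (rho t)%:E)%E.
  apply: ge0_nondecreasing_set_cvg_integral => //.
  - by move=> m n mn; apply/subsetPset; exact: ndF.
  - move=> n; apply/measurable_EFinP; apply: measurable_funS (F0 n) _ => //.
    exact: measurable_dual_weight.
  - by move=> n t _; rewrite lee_fin dual_weight_ge0.
rewrite -(cvg_lim _ cv)//; apply: lime_le; first by apply/cvg_ex; eexists; exact: cv.
exact: nearW.
Qed.

Lemma not_Bp_zero_large (c K : R) : 0 < c -> ~ Bp_zero p w ->
  exists x, [/\ 0 < x, x <= c & (K%:E < \int[mu]_(t in `[x, c]) (rho t)%:E)%E].
Proof.
move=> c0 nBp; apply: contrapT => H; apply: nBp.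
have intK x : 0 < x -> x <= c -> (\int[mu]_(t in `[x, c]) (rho t)%:E <= K%:E)%E.
  by move=> x0 xc; rewrite leNgt; apply/negP => Kx; apply: H; exists x.
pose F n := `[c / n.+1%:R, c]%classic : set R.
have Fpos n : 0 < c / n.+1%:R by rewrite divr_gt0.
have FE : `]0, c]%classic `<=` \bigcup_n F n.
  move=> t /=; rewrite in_itv/= => /andP[t0 tc].
  exists (Num.bound (c / t)) => //; rewrite /F/= in_itv/= tc andbT.
  rewrite ler_pdivrMr// mulrC -ler_pdivrMr// ltW//.
  apply: (@lt_trans _ _ (Num.bound (c / t))%:R); last by rewrite ltr_nat.
  by rewrite archi_boundP// ltW// divr_gt0.
have F0 n : F n `<=` `]0, +oo[.
  by move=> t; rewrite /F/= !in_itv/= andbT => /andP[+ _]; exact: lt_le_trans.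
apply: (dual_weight_lty_setU w_cont w_pos _ _ _ c0 (A := `]0, c]%classic) (y := 1)) => //.
- by move=> t /=; rewrite !in_itv/= andbT => /andP[].
- move=> t /=; rewrite !in_itv/= => /andP[t0 t1].
  by have [tc|tc] := leP t c; [left; rewrite t0|right; rewrite !ltW].
apply: le_lt_trans (ltry K).
apply: (@le_trans _ _ (\int[mu]_(t in \bigcup_n F n) (rho t)%:E)%E).
  apply: ge0_subset_integral => //.
  - by apply: bigcup_measurable => n _; exact: measurable_itv.
  - apply/measurable_EFinP; apply: measurable_funS (bigcup_sub (fun n _ => F0 n)) _ => //.
    exact: measurable_dual_weight.
  - by move=> t _; rewrite lee_fin dual_weight_ge0.
apply: integral_bigcup_le => //.
- by move=> n; exact: measurable_itv.
- move=> m n mn; apply: subset_itvr; rewrite bnd_simp ler_pM2l//.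
  by rewrite lef_pV2 ?posrE// ler_nat.
- by move=> n; apply: intK => //; rewrite ler_pdivrMr// ler_peMr// ?ler1n// ltW.
Qed.

Lemma not_Bp_infty_large (c K : R) : 0 < c -> ~ Bp_infty p w ->
  exists y, c <= y /\ (K%:E < \int[mu]_(t in `[c, y]) (rho t)%:E)%E.
Proof.
move=> c0 nBp; apply: contrapT => H; apply: nBp.
have intK y : c <= y -> (\int[mu]_(t in `[c, y]) (rho t)%:E <= K%:E)%E.
  by move=> cy; rewrite leNgt; apply/negP => Ky; apply: H; exists y.
apply: (dual_weight_lty_setU w_cont w_pos _ _ _ ltr01 (A := `[c, +oo[%classic) (y := c)) => //.
- by move=> t /=; rewrite !in_itv/= !andbT; exact: lt_le_trans.
- move=> t /=; rewrite !in_itv/= !andbT => t1.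
  by have [ct|tc] := leP c t; [left|right; rewrite !ltW].
apply: le_lt_trans (ltry K).
rewrite itv_bndy_bigcup_BRight; apply: integral_bigcup_le => //.
- move=> n t /=; rewrite !in_itv/= andbT => /andP[+ _]; exact: lt_le_trans.
- by move=> m n mn; apply: subset_itvl; rewrite bnd_simp lerD2l ler_nat.
- by move=> n; apply: intK; rewrite lerDl.
Qed.

Lemma eq_wLnorm (f g : R -> R) : (forall t, 0 < t -> `|f t| = `|g t|) ->
  wLnorm p w f = wLnorm p w g.
Proof.
move=> fg; rewrite /wLnorm; congr (_ `^ _)%E; apply: eq_integral => t.
by rewrite inE/= in_itv/= andbT => /fg ->.
Qed.

Lemma wLnorm0 : wLnorm p w (cst 0) = 0%E.
Proof.
have p0 : p != 0 by rewrite gt_eqF// (lt_trans _ hp).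
rewrite /wLnorm integral0_eq ?poweR0r ?invr_eq0// => t _.
by rewrite normr0 powR0// mul0r.
Qed.

Lemma derive1_cst (c : R) : derive1 (cst c : R -> R) = cst 0.
Proof. by apply/funext => t; rewrite derive1E derive_cst. Qed.

Lemma dirichlet_cst (c : R) : dirichlet p w (cst c).
Proof.
split.
  apply: (@lipschitz_loc_abs_continuous _ _ 0) => x y _ _.
  by rewrite subrr normr0 mul0r.
rewrite derive1_cst; split; first exact: measurable_cst.
by rewrite wLnorm0 ltry.
Qed.

Definition dirichlet_cst1 : dirichlet_space p w a :=
  exist _ (cst 1) (mem_set (dirichlet_cst 1)).

Lemma cst1_notin_R_zero : ~ R_zero p w a dirichlet_cst1.
Proof.
move=> /(_ 1 ltr01)[_]; rewrite /dirichlet_fun /= derive1_cst.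
by rewrite /Rintegral integral0_eq//= => /eqP; rewrite oner_eq0.
Qed.

Lemma cst1_notin_R_infty : ~ R_infty p w a dirichlet_cst1.
Proof.
move=> [v _ H]; have [iv _] := H 1 ltr01.
have /eqP : 1 = 0 :> R.
  apply: (constant_tail_eq0 iv) => s s1.
  by have [_ <-] := H s (lt_le_trans ltr01 s1).
by rewrite oner_eq0.
Qed.

(** Used with c = 0, s = 1 for transitions from 0 to 1, and with c = 1, s = -1
    for transitions from 1 to 0. *)
Lemma dirichlet_affine_primitive (x y : R) (v : R -> R) (s c : R) :
  x <= y -> continuous v -> (forall t, 0 <= v t) ->
  (forall t, t <= x -> v t = 0) -> (forall t, y <= t -> v t = 0) ->
  (wLnorm p w v < +oo)%E -> `|s| = 1 ->
  let f t := c + s * primitive v t in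
  dirichlet p w f /\
  (f a = 1 -> dirichlet_norm p w a (f \- cst 1) = wLnorm p w v).
Proof.
move=> xy vc v0 vl vr vfin s1 f.
have df t (d : R) : 0 < t -> derive1 (f \- cst d) t = s * v t.
  move=> t0; have dU := primitive_derivable vc vl vr t0.
  have -> : f \- cst d = (s \*: primitive v) + cst (c - d).
    by apply/funext => z; rewrite /f /= addrAC addrC.
  have dW : is_derive t 1 (s \*: primitive v + cst (c - d)) (s *: v t + 0).
    exact: is_deriveD.
  by rewrite derive1E derive_val addr0.
have fE : f = f \- cst 0 by apply/funext => t /=; rewrite subr0.
have nf d : wLnorm p w (derive1 (f \- cst d)) = wLnorm p w v.
  by apply: eq_wLnorm => t t0; rewrite df// normrM s1 mul1r.
split.
  split.
    move=> b b' b0 bb' e e0.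
    have [d d0 H] := primitive_loc_abs_continuous xy vc v0 vl vr b0 bb' e0.
    exists d => // n g h gh tI sd; apply: le_lt_trans (H n g h gh tI sd).
    apply: ler_sum => i _; rewrite /f opprD addrACA subrr add0r -mulrBr normrM.
    by rewrite s1 mul1r.
  rewrite fE; split; last by rewrite nf.
  apply: (eq_measurable_fun (fun t => s * v t)).
    by move=> t; rewrite inE/= in_itv/= andbT => t0; rewrite df.
  apply: measurable_funTS; apply: measurable_funM; first exact: measurable_cst.
  exact: continuous_measurable_fun.
by move=> fa; rewrite /dirichlet_norm nf /= fa subrr normr0 adde0.
Qed.

(** The bump lives between x/2 and [a], so that its primitive has reached the
    value 1 at the base point. *)
Lemma not_Bp_zero_not_closed : ~ Bp_zero p w -> ~ closed (R_zero p w a).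
Proof.
move=> nBp /dirichlet_closedP /(_ _ cst1_notin_R_zero)[r r0 rS].
have a20 : 0 < a / 2 by rewrite divr_gt0.
have [x [x0 xa Kx]] := not_Bp_zero_large ((r `^ p) `^ (- (p - 1)^-1)) a20 nBp.
have x20 : 0 < x / 2 by rewrite divr_gt0.
have h1 : x / 2 < x by lra.
have h2 : a / 2 < a by lra.
have [v [vc v0 vl vr [v1 vn]]] := bump_small_norm hp w_cont w_pos x20 h1 xa h2 r0 Kx.
have h3 : x / 2 <= a by lra.
have vfin := lt_trans vn (ltry r).
have [] := dirichlet_affine_primitive 0 h3 vc v0 vl vr vfin (normr1 R).
set f := fun t => _; move=> Df fnorm.
have fE : f = primitive v by apply/funext => t; rewrite /f add0r mul1r.
have fa : f a = 1 by rewrite fE (primitive_right x20 vl vr v1).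
apply: (rS (exist _ f (mem_set Df))).
  by rewrite /dirichlet_ball /dirichlet_fun /= (fnorm fa).
move=> t t0; rewrite /dirichlet_fun /= fE; split; last exact: (primitiveE vc vl vr).
have iv : mu.-integrable `]0, t] (EFin \o v).
  exact: integrableS (bump_integrable vc vl vr).
apply: eq_integrable iv => // z; rewrite inE/= in_itv/= => /andP[z0 _].
by rewrite (primitive_derive1 vc vl vr).
Qed.

(** The bump lives to the right of [a], so that 1 minus its primitive still
    has the value 1 at the base point. *)
Lemma not_Bp_infty_not_closed : ~ Bp_infty p w -> ~ closed (R_infty p w a).
Proof.
move=> nBp /dirichlet_closedP /(_ _ cst1_notin_R_infty)[r r0 rS].
have a20 : 0 < a * 2 by rewrite mulr_gt0.
have [y [ay Ky]] := not_Bp_infty_large ((r `^ p) `^ (- (p - 1)^-1)) a20 nBp.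
have h1 : a < a * 2 by lra.
have h2 : y < y + 1 by lra.
have [v [vc v0 vl vr [v1 vn]]] := bump_small_norm hp w_cont w_pos ha h1 ay h2 r0 Ky.
have h3 : a <= y + 1 by lra.
have vfin := lt_trans vn (ltry r).
have [] := dirichlet_affine_primitive 1 h3 vc v0 vl vr vfin (normrN1 R).
set f := fun t => _; move=> Df fnorm.
have fE t : f t = 1 - primitive v t by rewrite /f mulN1r.
have fa : f a = 1 by rewrite fE (primitive_left vl)// subr0.
apply: (rS (exist _ f (mem_set Df))).
  by rewrite /dirichlet_ball /dirichlet_fun /= (fnorm fa).
exists v; first by split => //; apply: measurable_funTS; exact: continuous_measurable_fun.
move=> t t0; split; first exact: integrableS (bump_integrable vc vl vr).
by rewrite /dirichlet_fun /= fE (primitive_complement ha vc vl vr v1).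
Qed.

End not_closed.

Unset Implicit Arguments.
Set Strict Implicit.
Set Printing Implicit Defensive.

Theorem theorem4p4 (R : realType) (p : R) (w : R -> R) (a : R)
    (hp : 1 < p)
    (w_cont : {within `]0, +oo[, continuous w})
    (w_pos : forall t : R, 0 < t -> 0 < w t)
    (ha : 0 < a) :
  (closed (R_zero p w a) <-> Bp_zero p w) /\
  (closed (R_infty p w a) <-> Bp_infty p w).
Proof.
split; split.
- by move=> cl; apply: contrapT => /(not_Bp_zero_not_closed hp w_cont w_pos ha).
- exact: Bp_zero_closed.
- by move=> cl; apply: contrapT => /(not_Bp_infty_not_closed hp w_cont w_pos ha).
- exact: Bp_infty_closed.
Qed.
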